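(* There is an absolute constant $C>0$ such that for every planar point-line system $(\mathcal{P},\mathcal{L})$ with $|\mathcal{P}|=N$ points (and any finite number $D$ of lines), $\mathrm{disc}(\mathbf{A}^{\mathcal{P},\mathcal{L}})\le C N^{1/6}$.
   Context: A planar point-line system $(\mathcal{P},\mathcal{L})$ consists of a finite set of $N$ points $\mathcal{P}\subseteq\mathbb{R}^2$ and a finite set $\mathcal{L}$ of $D$ lines in $\mathbb{R}^2$. Its adjacency matrix $\mathbf{A}^{\mathcal{P},\mathcal{L}}\in\{0,1\}^{\mathcal{L}\times\mathcal{P}}$ has entry $1$ at $(L,p)$ iff $p\in L$. For a matrix $\mathbf{A}$ with $N$ columns, $\mathrm{disc}(\mathbf{A}):=\min\{\|\mathbf{A}\mathbf{z}\|_\infty:\mathbf{z}\in\{-1,+1\}^N\}$. *)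

(* Defs.v *)
From mathcomp Require Import all_boot all_order all_algebra finmap.
From mathcomp Require Import all_classical all_reals all_analysis.

Set Implicit Arguments.
Unset Strict Implicit.
Unset Printing Implicit Defensive.

Import Order.TTheory GRing.Theory Num.Theory.

Local Open Scope classical_set_scope.
Local Open Scope ring_scope.

Definition is_line (R : realType) (l : set (R * R)) : Prop :=
  exists a b c : R, (a, b) <> (0, 0) /\ l = [set p | a * p.1 + b * p.2 = c].

Definition point_line_system (R : realType)
    (P : {fset R * R}) (L : {fset set (R * R)}) : Prop :=
  forall l, l \in L -> is_line l.

(* Rows and columns follow the duplicate-free enumerations of [L] and [P], so
   the defaults of [nth] are never reached. *)
Definition adjacency_mx (R : realType)
    (P : {fset R * R}) (L : {fset set (R * R)}) : 'M[R]_(#|` L|, #|` P|) :=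
  \matrix_(i, j)
    (nth (0, 0) (enum_fset P) j \in nth set0 (enum_fset L) i)%:R.

(* {-1, +1}^N is parametrised by the Boolean vectors of length N. *)
Definition sign_vec (R : realType) (N : nat) (s : {ffun 'I_N -> bool}) :
    'cV[R]_N :=
  \col_j (-1) ^+ s j.

(* The library norm on 'cV[R]_D is the maximum norm. *)
Definition disc (R : realType) (D N : nat) (A : 'M[R]_(D, N)) : R :=
  let f (s : {ffun 'I_N -> bool}) : R := `|A *m sign_vec R s| in
  f [arg min_(s < [ffun=> false]) f s]%O.

Lemma sign_vecP (R : realType) (N : nat) (z : 'cV[R]_N) :
  (forall j, z j 0 = -1 \/ z j 0 = 1) <-> exists s, z = sign_vec R s.
Proof.
split=> [zP | [s ->] j]; last first.
  by rewrite mxE; case: (s j); [left; rewrite expr1 | right; rewrite expr0].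
exists [ffun j => z j 0 == -1]; apply/colP => j; rewrite mxE ffunE.
case: eqVneq => [-> | zN]; first by rewrite expr1.
by rewrite expr0; case: (zP j) => // zE; rewrite zE eqxx in zN.
Qed.

Lemma disc_min (R : realType) (D N : nat) (A : 'M[R]_(D, N)) :
  (exists s, disc A = `|A *m sign_vec R s|) /\
  (forall s, disc A <= `|A *m sign_vec R s|).
Proof.
rewrite /disc; case: arg_minP => //= s _ sP.
by split=> [|t]; [exists s | exact: sP].
Qed.

Lemma norm_cV_max (R : realType) (D : nat) (v : 'cV[R]_D) :
  `|v| = \big[Num.max/0]_i `|v i 0|.
Proof.
rewrite [LHS]mx_normrE; apply/eqP; rewrite eq_le; apply/andP; split.
  apply/bigmax_leP; split=> [|[i j] _ /=]; first exact: bigmax_ge_id.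
  by rewrite (ord1 j); exact: (le_bigmax _ (fun i => `|v i 0|)).
apply/bigmax_leP; split=> [|i _]; first exact: bigmax_ge_id.
exact: (le_bigmax _ (fun ij : 'I_D * 'I_1 => `|v ij.1 ij.2|) (i, 0)).
Qed.

(* Main.v *)
Require Import Defs.
From mathcomp Require Import all_boot all_order all_algebra finmap.
From mathcomp Require Import all_classical all_reals all_analysis.
From mathcomp Require Import ring lra zify.

(** Szemerédi-Trotter: among [n] points, at most [O(n^2/k^3 + n/k)] lines are
    [k]-rich.  Join consecutive points on every such line: each pair of lines
    gives at most one crossing, while a straight-line graph without crossings
    has at most [3n] edges, so a random sample of the points gives the bound.

    Partial coloring: round each signed line sum of a random coloring to a
    multiple of [2 Delta], with [Delta] of order [n^(1/6)].  The typical line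
    has [k = n^(1/3)] points, where [n^2/k^3 = n], and the bound on rich lines
    makes the rounded vector have entropy at most [n/16].  Hence some value of it
    is shared by two colorings that differ in at least [n/8] points, and half
    their difference colors those points with discrepancy at most [Delta] on
    every line.  Iterating on the uncolored points gives a geometric series. *)

Set Implicit Arguments.
Unset Strict Implicit.
Unset Printing Implicit Defensive.

Import Order.TTheory GRing.Theory Num.Theory.

Local Open Scope ring_scope.

(** * Straight-line graphs without crossings *)

Section StraightGraph.
Variables (R : realFieldType) (V : finType) (x y : V -> R).
Implicit Types (e f g : V * V) (z : R).

Definition slope e : R := (y e.2 - y e.1) / (x e.2 - x e.1).

Definition chord e z : R := y e.1 + slope e * (z - x e.1).

Definition in_span e z : bool := x e.1 < z < x e.2.

(** Both spans are open: edges that only share an endpoint do not cross, while collinear edges with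
    overlapping spans do. *)
Definition cross e f : Prop :=
  exists z, [/\ in_span e z, in_span f z & chord e z = chord f z].

Lemma chord_left e : chord e (x e.1) = y e.1.
Proof. by rewrite /chord subrr mulr0 addr0. Qed.

Lemma chord_right e : x e.1 < x e.2 -> chord e (x e.2) = y e.2.
Proof.
move=> lt_e; rewrite /chord /slope divfK; last by rewrite subr_eq0 gt_eqF.
by rewrite addrC subrK.
Qed.

(** The difference of the chords is affine and vanishes at a convex combination of [z1] and [z2]. As
    [z1] has positive weight, the zero is strictly inside both spans even if [z2] is an endpoint. *)
Lemma cross_of_swap e f z1 z2 :
  in_span e z1 -> in_span f z1 ->
  x e.1 <= z2 <= x e.2 -> x f.1 <= z2 <= x f.2 ->
  chord e z1 < chord f z1 -> chord f z2 < chord e z2 -> cross e f.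
Proof.
move=> /andP[a1 a2] /andP[b1 b2] /andP[c1 c2] /andP[d1 d2] lt1 lt2.
pose g1 := chord f z1 - chord e z1; pose g2 := chord e z2 - chord f z2.
have g1_gt0 : 0 < g1 by rewrite subr_gt0.
have g2_gt0 : 0 < g2 by rewrite subr_gt0.
have g_gt0 : 0 < g1 + g2 by exact: addr_gt0.
pose t := g1 / (g1 + g2).
have t_gt0 : 0 < t by exact: divr_gt0.
have t_lt1 : t < 1 by rewrite ltr_pdivrMr // mul1r ltrDl.
have tE : t * (g1 + g2) = g1 by rewrite divfK // gt_eqF.
exists (z1 + t * (z2 - z1)); split.
- by apply/andP; split; nra.
- by apply/andP; split; nra.
- apply/subr0_eq.
  have -> : chord e (z1 + t * (z2 - z1)) - chord f (z1 + t * (z2 - z1)) =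
      t * (g1 + g2) - g1 by rewrite /g1 /g2 /chord; ring.
  by rewrite tE subrr.
Qed.

Lemma chord_le_span e f z1 z2 :
  ~ cross e f -> in_span e z1 -> in_span f z1 ->
  x e.1 <= z2 <= x e.2 -> x f.1 <= z2 <= x f.2 ->
  chord e z1 < chord f z1 -> chord e z2 <= chord f z2.
Proof.
move=> ncr e1 f1 e2 f2 lt1; rewrite leNgt; apply/negP => lt2.
by apply: ncr; exact: cross_of_swap e1 f1 e2 f2 lt1 lt2.
Qed.

(** The common left end is excluded but right ends are not, so the wedge under a steeper edge [f]
    always contains the right end of the shorter edge. *)
Definition in_wedge e f (w : V) : bool :=
  [&& x e.1 < x w, x w <= x e.2, x w <= x f.2,
      chord e (x w) <= y w & y w <= chord f (x w)].

Variables (S : {set V}) (E : {set V * V}).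
Hypothesis x_inj : injective x.
Hypothesis E_edge : forall e, e \in E -> [/\ x e.1 < x e.2, e.1 \in S & e.2 \in S].
Hypothesis E_ncross : forall e f, e \in E -> f \in E -> e != f -> ~ cross e f.
Hypothesis E_empty : forall e w,
  e \in E -> w \in S -> in_span e (x w) -> y w <> chord e (x w).

Definition top_edge e : bool :=
  [forall f in E, (f.1 == e.1) ==> (slope f <= slope e)].

(* [f] is the next edge above [e] at their common left end, and [w] is the
   leftmost vertex of the closed wedge between them.  The edge [e] is then
   determined by [w] and by whether [e] ends at [w]. *)
Definition charged e f (w : V) : bool :=
  [&& f \in E, f.1 == e.1, slope e < slope f,
      [forall g in E, (g.1 == e.1) ==> (slope e < slope g) ==>
         (slope f <= slope g)],
      w \in S, in_wedge e f w &
      [forall u in S, in_wedge e f u ==> (x w <= x u)]].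

Lemma slope_inj_left e f :
  e \in E -> f \in E -> e.1 = f.1 -> slope e = slope f -> e = f.
Proof.
move=> eE fE e1 es; apply/eqP/negPn/negP => /(E_ncross eE fE); apply.
have [lte _ _] := E_edge eE; have [ltf _ _] := E_edge fE.
pose m := Num.min (x e.2) (x f.2).
have me : m <= x e.2 by rewrite ge_min lexx.
have mf : m <= x f.2 by rewrite ge_min lexx orbT.
have lm : x e.1 < m by rewrite lt_min lte e1.
exists ((x e.1 + m) / 2); split.
- by apply/andP; split; lra.
- by apply/andP; split; rewrite -?e1; lra.
- by rewrite /chord es e1.
Qed.

Lemma card_top_edges : (#|[set e in E | top_edge e]| <= #|S|)%N.
Proof.
have inj : {in [set e in E | top_edge e] &, injective (fun e : V * V => e.1)}.
  move=> e f; rewrite !inE => /andP[eE /forall_inP te] /andP[fE /forall_inP tf] ef.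
  apply: slope_inj_left => //; apply/eqP; rewrite eq_le.
  have /implyP-> := tf _ eE; last by rewrite ef.
  by have /implyP-> := te _ fE; last by rewrite ef.
rewrite -(card_in_imset inj); apply/subset_leq_card/fintype.subsetP => v /imsetP[e].
by rewrite inE => /andP[/E_edge[_ e1 _] _] ->.
Qed.

Lemma charged_ex e : e \in E -> ~~ top_edge e -> exists f w, charged e f w.
Proof.
move=> eE; rewrite negb_forall_in => /existsP[f0 /andP[f0E]].
rewrite negb_imply -ltNge => /andP[f01 f0s].
pose above f := [&& f \in E, f.1 == e.1 & slope e < slope f].
have ab0 : above f0 by rewrite /above f0E f01.
case: (@arg_minP _ _ _ f0 above slope ab0) => f /and3P[fE /eqP f1 fs] fmin.
have [lte _ e2S] := E_edge eE; have [ltf _ f2S] := E_edge fE.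
have chle z : x e.1 <= z -> chord e z <= chord f z.
  by move=> lez; rewrite /chord f1; nra.
pose P w := (w \in S) && in_wedge e f w.
have [w0 Pw0] : exists w0, P w0.
  have [le2|lt2] := leP (x e.2) (x f.2).
    exists e.2; rewrite /P e2S /in_wedge lte lexx le2 chord_right // lexx /=.
    by rewrite -[leLHS]chord_right // chle // ltW.
  rewrite f1 in ltf.
  exists f.2; rewrite /P f2S /in_wedge ltf lexx (ltW lt2) chord_right ?f1 //.
  by rewrite lexx andbT /= -chord_right ?f1 // chle // ltW.
case: (@arg_minP _ _ _ w0 P x Pw0) => w /andP[wS wP] wmin.
exists f, w; apply/and5P; split=> //; first by rewrite f1.
  apply/forall_inP => g gE; apply/implyP => g1; apply/implyP => gs.
  by apply: fmin; rewrite /above gE g1.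
rewrite wS wP; apply/forall_inP => u uS; apply/implyP => uw.
by apply: wmin; rewrite /P uS.
Qed.

(** Comparing chords at such a [z] stands for comparing them just to the left of [w]: no edge starts
    or ends in between. *)
Lemma left_gap (v w : V) : x v < x w ->
  exists2 z, z < x w & forall u, x u < x w -> x u < z.
Proof.
move=> ltvw; case: (@arg_maxP _ _ _ v (fun u => x u < x w) x ltvw) => u ltuw umax.
exists ((x u + x w) / 2); first by lra.
by move=> u' /umax le_u; have : x u' <= x u by []; lra.
Qed.

(** The left end of an edge [g] running between [e] and [f] just before [w] has nowhere to be. At
    [e.1], its slope contradicts the choice of [f]; further left, [g] is squeezed through [e.1],
    which [E_empty] forbids; further right, it is a vertex of the wedge preceding [w]. *)
Lemma charged_empty e f g w z :
  e \in E -> charged e f w -> z < x w -> (forall u, x u < x w -> x u < z) ->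
  g \in E -> in_span g z -> chord e z < chord g z -> ~~ (chord g z < chord f z).
Proof.
move=> eE /and5P[fE /eqP f1 efs /forall_inP fmin /and3P[wS]].
move=> /and5P[lw we wf _ _] /forall_inP wmin zw zP gE gz eg; apply/negP => gf.
have [_ e1S _] := E_edge eE; have [ltg g1S _] := E_edge gE.
have ez : in_span e z by apply/andP; split; [exact: zP | exact: lt_le_trans we].
have fz : in_span f z.
  by apply/andP; split; [rewrite f1; exact: zP | exact: lt_le_trans wf].
have neg : ~ cross e g.
  by apply: E_ncross => //; apply: contraTneq eg => ->; rewrite ltxx.
have ngf : ~ cross g f.
  by apply: E_ncross => //; apply: contraTneq gf => ->; rewrite ltxx.
have /andP[ez1 ez2] := ez; have /andP[fz1 fz2] := fz; have /andP[gz1 gz2] := gz.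
have [g1|] := eqVneq g.1 e.1.
  have sg : slope e < slope g.
    by move: eg; rewrite /chord g1; nra.
  have /implyP/(_ sg) := implyP (fmin g gE) (introT eqP g1).
  by move: gf; rewrite /chord g1 f1; nra.
rewrite -(inj_eq x_inj) neq_lt => /orP[lt1|lt1].
  apply: (@E_empty g e.1) => //; first by rewrite /in_span lt1; exact: lt_trans gz2.
  apply/eqP; rewrite eq_le; apply/andP; split.
    rewrite -[leLHS]chord_left; apply: chord_le_span neg ez gz _ _ eg.
      by rewrite lexx ltW // (lt_trans ez1).
    by rewrite ltW // ltW // (lt_trans ez1).
  rewrite -f1 -[leRHS]chord_left; apply: chord_le_span ngf gz fz _ _ gf.
    by rewrite f1 ltW // ltW // (lt_trans ez1).
  by rewrite lexx ltW // (lt_trans fz1).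
have : x g.1 < x w by exact: lt_trans zw.
apply/negP; rewrite -leNgt; apply: (implyP (wmin _ g1S)).
rewrite /in_wedge lt1 (ltW (lt_trans gz1 ez2)) (ltW (lt_trans gz1 fz2)) /=.
rewrite -(chord_left g); apply/andP; split.
  apply: chord_le_span neg ez gz _ _ eg; last by rewrite lexx ltW.
  by rewrite !ltW // (lt_trans gz1).
apply: chord_le_span ngf gz fz _ _ gf; first by rewrite lexx ltW.
by rewrite f1 !ltW // (lt_trans gz1).
Qed.

(** No edge runs inside the wedge of [e1], so [f1] is at or below [e2] at [z], hence also above [w].
    There the two wedge conditions squeeze both edges onto [w], and by [E_empty] they end at it. *)
Lemma charged_lt e1 f1 e2 f2 w z :
  e1 \in E -> e2 \in E -> charged e1 f1 w -> charged e2 f2 w ->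
  z < x w -> (forall u, x u < x w -> x u < z) ->
  chord e1 z < chord e2 z -> f1.2 = w /\ e2.2 = w.
Proof.
move=> e1E e2E c1 c2 zw zP lt12.
have /and5P[f1E /eqP f11 _ _ /and3P[wS /and5P[lw1 we1 wf1 _ w1] _]] := c1.
have /and5P[_ _ _ _ /and3P[_ /and5P[lw2 we2 _ w2 _] _]] := c2.
have e2z : in_span e2 z by rewrite /in_span (zP _ lw2) (lt_le_trans zw).
have f1z : in_span f1 z by rewrite /in_span f11 (zP _ lw1) (lt_le_trans zw).
have := charged_empty e1E c1 zw zP e2E e2z lt12; rewrite -leNgt => le12.
have le12w : chord f1 (x w) <= chord e2 (x w).
  have [-> //|ne] := eqVneq f1 e2.
  have ncr := E_ncross f1E e2E ne.
  apply: (chord_le_span ncr f1z e2z).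
  - by rewrite f11 (ltW lw1).
  - by rewrite (ltW lw2).
  - rewrite lt_neqAle le12 andbT; apply/eqP => eq12.
    by apply: ncr; exists z.
split; apply/eqP; rewrite -(inj_eq x_inj) eq_le.
  rewrite wf1 andbT leNgt; apply/negP => ltw.
  apply: (@E_empty f1 w) => //; first by rewrite /in_span f11 lw1.
  by apply/eqP; rewrite eq_le w1 (le_trans le12w).
rewrite we2 andbT leNgt; apply/negP => ltw.
apply: (@E_empty e2 w) => //; first by rewrite /in_span lw2.
by apply/eqP; rewrite eq_le w2 andbT (le_trans w1).
Qed.

Lemma charged_inj e1 f1 e2 f2 w :
  e1 \in E -> e2 \in E -> charged e1 f1 w -> charged e2 f2 w ->
  (e1.2 == w) = (e2.2 == w) -> e1 = e2.
Proof.
(* The edges may be ordered just to the left of [w]; without crossings this order does not depend on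
   [z]. *)
wlog: e1 f1 e2 f2 / forall z, z < x w -> (forall u, x u < x w -> x u < z) ->
    chord e1 z <= chord e2 z.
  move=> IH e1E e2E c1 c2 ew.
  have /and5P[_ _ _ _ /and3P[_ /and5P[lw1 we1 _ _ _] _]] := c1.
  have /and5P[_ _ _ _ /and3P[_ /and5P[lw2 we2 _ _ _] _]] := c2.
  have gap_le e e' z z' : e \in E -> e' \in E -> x e.1 < x w -> x e'.1 < x w ->
      x w <= x e.2 -> x w <= x e'.2 -> z < x w -> z' < x w ->
      (forall u, x u < x w -> x u < z) -> (forall u, x u < x w -> x u < z') ->
      chord e z < chord e' z -> chord e z' <= chord e' z'.
    move=> eE e'E l l' r r' zw z'w zP z'P lt.
    have ne : e != e' by apply: contraTneq lt => ->; rewrite ltxx.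
    apply: chord_le_span (E_ncross eE e'E ne) _ _ _ _ lt; rewrite /in_span.
    - by rewrite zP // (lt_le_trans zw).
    - by rewrite zP // (lt_le_trans zw).
    - by rewrite !ltW ?z'P // (lt_le_trans z'w).
    - by rewrite !ltW ?z'P // (lt_le_trans z'w).
  have [z zw zP] := left_gap lw1.
  have [lt|lt|eqz] := ltgtP (chord e1 z) (chord e2 z).
  - by apply: IH c1 c2 ew => // z' z'w z'P; exact: gap_le lt.
  - by apply/esym/(IH e2 f2 e1 f1) => // z' z'w z'P; exact: gap_le lt.
  - apply/eqP/negPn/negP => /(E_ncross e1E e2E); apply; exists z.
    by rewrite /in_span !zP // !(lt_le_trans zw).
move=> le12 e1E e2E c1 c2 ew; apply/eqP/negPn/negP => ne.
have /and5P[f1E /eqP f11 f1s _ /and3P[_ /and5P[lw1 we1 _ _ _] _]] := c1.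
have /and5P[_ _ _ _ /and3P[_ /and5P[lw2 we2 _ _ _] _]] := c2.
have [z zw zP] := left_gap lw1.
have lt12 : chord e1 z < chord e2 z.
  rewrite lt_neqAle le12 // andbT; apply/eqP => eqz.
  apply: (E_ncross e1E e2E ne); exists z.
  by rewrite /in_span !zP // !(lt_le_trans zw).
(* Since [e2] ends at [w], so does [e1]; then [e1] and [f1] share both ends, although [f1] is
   steeper. *)
have [fw ew2] := charged_lt e1E e2E c1 c2 zw zP lt12.
move: ew; rewrite ew2 eqxx => /eqP e1w.
have e1f1 : e1 = f1 by rewrite (surjective_pairing e1) (surjective_pairing f1) f11 e1w fw.
by move: f1s; rewrite -e1f1 ltxx.
Qed.

Theorem noncrossing_card : (#|E| <= 3 * #|S|)%N.
Proof.
pose N := [set e in E | ~~ top_edge e].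
have cardE : #|E| = (#|[set e in E | top_edge e]| + #|N|)%N.
  rewrite -(cardsID [set e | top_edge e] E); congr (_ + _)%N; apply: eq_card => e.
    by rewrite !inE.
  by rewrite !inE andbC.
suff cardN : (#|N| <= 2 * #|S|)%N by have := card_top_edges; lia.
(* The default [e.1] is never reached on [N], by [charged_ex]. *)
pose h e : V := odflt e.1 [pick w | [exists f, charged e f w]].
have hP e : e \in N -> exists f, charged e f (h e).
  rewrite inE => /andP[eE /(charged_ex eE)[f [w efw]]]; rewrite /h.
  case: pickP => [w' /existsP[f' ?]|/(_ w)/existsP[]]; first by exists f'.
  by exists f.
pose H e : bool * V := (e.2 == h e, h e).
have injH : {in N &, injective H}.
  move=> e1 e2 e1N e2N [].
  have [f1 c1] := hP _ e1N; have [f2 c2] := hP _ e2N => ew hw.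
  move: e1N e2N; rewrite !inE => /andP[e1E _] /andP[e2E _].
  by apply: (charged_inj e1E e2E c1 (f2 := f2)); [rewrite hw | rewrite ew hw].
rewrite -(card_in_imset injH).
have -> : (2 * #|S| = #|finset.setX [set: bool] S|)%N by rewrite cardsX cardsT card_bool.
apply/subset_leq_card/fintype.subsetP => _ /imsetP[e eN ->]; rewrite !inE /=.
by have [f /and5P[_ _ _ _ /and3P[]]] := hP _ eN.
Qed.

End StraightGraph.

(** * Random sampling *)

Section Sampling.
Variables (V : finType) (q : nat).

(** A uniform [s] keeps each vertex independently with probability [1 / q.+1]. *)
Definition sample (s : {ffun V -> 'I_q.+1}) : {set V} := [set v | s v == ord0].

Lemma card_sample_sup (A : {set V}) :
  (#|[set s | A \subset sample s]| * q.+1 ^ #|A| = q.+1 ^ #|V|)%N.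
Proof.
pose F v : pred 'I_q.+1 := if v \in A then pred1 ord0 else predT.
have -> : #|[set s | A \subset sample s]| = #|(family F : simpl_pred _)|.
  apply: eq_card => s; rewrite inE; apply/fintype.subsetP/familyP => [sA v|sF v vA].
    by rewrite /F; case: ifP => // /sA; rewrite !inE.
  by have := sF v; rewrite /F vA !inE.
rewrite card_family foldrE big_map big_enum /=.
have -> : (\prod_v #|F v| = \prod_(v in ~: A) q.+1)%N.
  rewrite [RHS]big_mkcond; apply: eq_bigr => v _; rewrite inE /F.
  by case: ifP => _ /=; rewrite ?card1 ?card_ord.
by rewrite prod_nat_const -expnD addnC cardsC.
Qed.

(** Linearity of expectation, with denominators cleared. *)
Lemma sum_card_sample (D : finType) (Y : {set D}) (A : D -> {set V}) k :
  (forall d, d \in Y -> #|A d| = k) ->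
  ((\sum_s #|[set d in Y | A d \subset sample s]|) * q.+1 ^ k =
   #|Y| * q.+1 ^ #|V|)%N.
Proof.
move=> cardA.
have -> : (\sum_s #|[set d in Y | A d \subset sample s]| =
    \sum_(d in Y) #|[set s | A d \subset sample s]|)%N.
  under eq_bigr do rewrite -sum1dep_card.
  under [in RHS]eq_bigr do rewrite -sum1dep_card.
  by rewrite [RHS](exchange_big_dep predT).
rewrite big_distrl /= -sum_nat_const; apply: eq_bigr => d dY.
by rewrite -(cardA d dY) card_sample_sup.
Qed.

End Sampling.

(** * Rich lines *)

Section RichLines.
Variables (R : realFieldType) (V I : finType) (x y : V -> R) (a c : I -> R).
Hypothesis x_inj : injective x.
Hypothesis line_inj : forall i j, a i = a j -> c i = c j -> i = j.
Variables (S : {set V}) (J : {set I}).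
Implicit Types (e f : V * V) (i j : I).

Definition line_points i : {set V} := [set v in S | y v == a i * x v + c i].

Definition segment i e : bool :=
  [&& e.1 \in line_points i, e.2 \in line_points i, x e.1 < x e.2 &
      [forall w in line_points i, ~~ in_span x e (x w)]].

Definition segments : {set V * V} := [set e | [exists i in J, segment i e]].

Lemma line_pointsE i v : v \in line_points i -> y v = a i * x v + c i.
Proof. by rewrite inE => /andP[_ /eqP]. Qed.

Lemma line_eq i j z1 z2 :
  a i * z1 + c i = a j * z1 + c j -> a i * z2 + c i = a j * z2 + c j ->
  z1 != z2 -> i = j.
Proof.
move=> eq1 eq2 ne.
have aij : a i = a j.
  apply/eqP; rewrite -subr_eq0; have /eqP : (a i - a j) * (z1 - z2) = 0 by lra.
  by rewrite mulf_eq0 (subr_eq0 z1) (negbTE ne) orbF.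
by apply: line_inj => //; move: eq1; rewrite aij => /addrI.
Qed.

Lemma segment_chord i e z : segment i e -> chord x y e z = a i * z + c i.
Proof.
move=> /and4P[/line_pointsE e1 /line_pointsE e2 lt_e _].
rewrite /chord /slope e1 e2.
have -> : (a i * x e.2 + c i - (a i * x e.1 + c i)) = a i * (x e.2 - x e.1) by ring.
by rewrite mulfK ?subr_eq0 ?gt_eqF //; ring.
Qed.

Lemma segment_line i j e : segment i e -> segment j e -> i = j.
Proof.
move=> ie je; have /and4P[_ _ lt_e _] := ie.
apply: (@line_eq _ _ (x e.1) (x e.2)); last by rewrite lt_eqF.
  by rewrite -(segment_chord _ ie) -(segment_chord _ je).
by rewrite -(segment_chord _ ie) -(segment_chord _ je).
Qed.

Lemma segment_span_inj i e f z :
  segment i e -> segment i f -> in_span x e z -> in_span x f z -> e = f.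
Proof.
move=> /and4P[e1 e2 _ /forall_inP eE] /and4P[f1 f2 _ /forall_inP fE].
move=> /andP[ez1 ez2] /andP[fz1 fz2].
rewrite (surjective_pairing e) (surjective_pairing f); congr (_, _);
  apply/eqP; rewrite -(inj_eq x_inj) eq_le !leNgt; apply/andP; split;
  apply/negP => lt.
- by have /negP[] := fE _ e1; rewrite /in_span lt (lt_trans ez1).
- by have /negP[] := eE _ f1; rewrite /in_span lt (lt_trans fz1).
- by have /negP[] := eE _ f2; rewrite /in_span lt andbT (lt_trans ez1).
- by have /negP[] := fE _ e2; rewrite /in_span lt andbT (lt_trans fz1).
Qed.

Definition crossings : {set (V * V) * (V * V)} :=
  [set p | [&& p.1 \in segments, p.2 \in segments, p.1 != p.2 &
               `[< cross x y p.1 p.2 >]]].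

Lemma crossingP e f : (e, f) \in crossings ->
  exists i j z, [/\ [/\ i \in J, j \in J & i != j], segment i e /\ segment j f,
    in_span x e z /\ in_span x f z & a i * z + c i = a j * z + c j].
Proof.
rewrite finset.in_set => /= /and4P[]; rewrite 2!finset.in_set.
move=> /existsP[i /andP[iJ ie]] /existsP[j /andP[jJ jf]] ne /asboolP[z [ez fz]].
rewrite (segment_chord _ ie) (segment_chord _ jf) => eqz.
exists i, j, z; split=> //; split=> //.
by apply: contra_neq ne => ij; apply: segment_span_inj ie _ ez fz; rewrite ij.
Qed.

(** A crossing is determined by the ordered pair of its lines: they meet at one abscissa, and on
    each line only one segment has it in its open span. *)
Lemma card_crossings : (#|crossings| <= #|J| ^ 2)%N.
Proof.
have [-> | [[e0 f0] /crossingP[i0 _]]] := set_0Vmem crossings; first by rewrite cards0.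
pose l e : I := odflt i0 [pick i in J | segment i e].
have lE i e : i \in J -> segment i e -> l e = i.
  move=> iJ ie; rewrite /l; case: pickP => [j /andP[_ je]|/(_ i)].
    exact: segment_line je ie.
  by rewrite iJ ie.
have inj : {in crossings &, injective (fun p => (l p.1, l p.2))}.
  move=> [e f] [e' f'] /crossingP[i [j [z [[iJ jJ ij] [ie jf] [ez fz] eqz]]]].
  move=> /crossingP[i' [j' [z' [[i'J j'J _] [ie' jf'] [ez' fz'] eqz']]]] [] /=.
  rewrite (lE i e) // (lE j f) // (lE i' e') // (lE j' f') // => ii' jj'.
  rewrite -ii' -jj' in ie' jf' eqz'.
  have zz' : z = z'.
    by apply/eqP; apply: contraNT ij => /(line_eq eqz eqz') ->.
  by congr (_, _); [apply: segment_span_inj ie ie' ez _ |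
                    apply: segment_span_inj jf jf' fz _]; rewrite zz'.
rewrite -(card_in_imset inj) -mulnn -cardsX.
apply/subset_leq_card/fintype.subsetP => _ /imsetP[[e f] efX ->].
have [i [j [z [[iJ jJ _] [ie jf] _ _]]]] := crossingP efX.
by rewrite !inE /= (lE i e) // (lE j f) // iJ jJ.
Qed.

Definition ends (p : (V * V) * (V * V)) : {set V} :=
  [set p.1.1; p.1.2] :|: [set p.2.1; p.2.2].

Lemma card_segment_ends e : e \in segments -> #|[set e.1; e.2]| = 2%N.
Proof.
rewrite inE => /existsP[i /and5P[_ _ _ lt_e _]].
by rewrite cards2 -(inj_eq x_inj) lt_eqF.
Qed.

(** The two lines are distinct and meet only at the crossing, which is interior to both segments, so
    no end is shared. *)
Lemma card_crossing_ends p : p \in crossings -> #|ends p| = 4%N.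
Proof.
case: p => e f pX; have := pX; rewrite inE => /and4P[/= eE fE _ _].
have [i [j [z [[_ _ ij] [ie jf] [ez fz] eqz]]]] := crossingP pX.
rewrite /ends cardsU !card_segment_ends //=.
suff -> : [set e.1; e.2] :&: [set f.1; f.2] = finset.set0 by rewrite cards0.
apply/finset.setP => v; rewrite !inE; apply/negbTE/negP => /andP[ve vf].
have /and4P[e1 e2 _ _] := ie; have /and4P[f1 f2 _ _] := jf.
have vi : v \in line_points i by case/orP: ve => /eqP->.
have vj : v \in line_points j by case/orP: vf => /eqP->.
have /eqP vz : x v == z.
  apply: contraNT ij => ne; apply/eqP; apply: line_eq eqz ne.
  by rewrite -!line_pointsE.
move: ez; rewrite -vz /in_span => /andP[].
by case/orP: ve => /eqP->; rewrite ?ltxx.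
Qed.

(** Removing the first edge of every crossing from the graph induced on [S'] leaves a graph without
    crossings. *)
Lemma card_segments_in (S' : {set V}) : S' \subset S ->
  (#|[set e in segments | [set e.1; e.2] \subset S']| <=
   3 * #|S'| + #|[set p in crossings | ends p \subset S']|)%N.
Proof.
move=> sS.
set E := [set e in _ | _]; set X := [set p in _ | _].
pose E' := E :\: (fst @: X).
have cardE' : (#|E'| <= 3 * #|S'|)%N.
  apply: (@noncrossing_card _ _ x y) => //.
  - move=> e; rewrite !inE finset.subUset !finset.sub1set.
    by move=> /andP[_ /andP[/existsP[i /and5P[_ _ _ ? _]] /andP[? ?]]].
  - move=> e f; rewrite 2!inE => /andP[/imsetP eX eE]; rewrite 2!inE => /andP[_ fE] ne cr.
    apply: eX; exists (e, f) => //; rewrite inE.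
    move: eE fE; rewrite !inE /= => /andP[-> eS] /andP[-> fS].
    by rewrite ne /ends finset.subUset eS fS !andbT /=; apply/asboolP.
  - move=> e w; rewrite !inE => /andP[_ /andP[/existsP[i /andP[_ ie]] _]] wS we.
    rewrite (segment_chord _ ie) => yw.
    have /and4P[_ _ _ /forall_inP/(_ w)] := ie.
    by rewrite we inE (fintype.subsetP sS) // yw eqxx => /(_ isT).
rewrite -(cardsID (fst @: X) E) addnC leq_add //.
apply: leq_trans (leq_imset_card fst _).
by apply/subset_leq_card/finset.subsetIr.
Qed.

(** Averages [card_segments_in] over samples of density [1 / Q], where [Q = q.+1]: a point survives
    with probability [Q^-1], a segment with [Q^-2], a crossing with [Q^-4]. Everything is then
    multiplied by [Q^4]. *)
Lemma crossing_bound q :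
  (#|segments| * q.+1 ^ 2 <= 3 * #|S| * q.+1 ^ 3 + #|J| ^ 2)%N.
Proof.
pose P s := [set v in S | [set v] \subset @sample V q s].
have PS s : P s \subset S by apply/fintype.subsetP => v; rewrite inE => /andP[].
have inP s (A : {set V}) : A \subset S -> (A \subset P s) = (A \subset sample s).
  move=> AS; apply/fintype.subsetP/fintype.subsetP => As v vA; have := As v vA.
    by rewrite !inE finset.sub1set inE => /andP[].
  by rewrite !inE finset.sub1set inE (fintype.subsetP AS).
have segS e : e \in segments -> [set e.1; e.2] \subset S.
  rewrite inE => /existsP[i /and5P[_ e1 e2 _ _]]; apply/fintype.subsetP => v.
  by rewrite !inE => /orP[] /eqP->; [move: e1 | move: e2]; rewrite inE => /andP[].
have cell s : (#|[set e in segments | [set e.1; e.2] \subset sample s]| <=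
    3 * #|P s| + #|[set p in crossings | ends p \subset sample s]|)%N.
  have eqE : [set e in segments | [set e.1; e.2] \subset sample s] =
      [set e in segments | [set e.1; e.2] \subset P s].
    apply/finset.setP => e; rewrite finset.in_set [RHS]finset.in_set.
    by case: (boolP (e \in segments)) => //= eE; rewrite inP // segS.
  have eqX : [set p in crossings | ends p \subset sample s] =
      [set p in crossings | ends p \subset P s].
    apply/finset.setP => p; rewrite finset.in_set [RHS]finset.in_set.
    case: (boolP (p \in crossings)) => //=; rewrite inE => /and4P[e1 e2 _ _].
    by rewrite inP // finset.subUset !segS.
  by rewrite eqE eqX; apply: card_segments_in.
have : (\sum_(s : {ffun V -> 'I_q.+1})
      #|[set e in segments | [set e.1; e.2] \subset sample s]| <=
    \sum_(s : {ffun V -> 'I_q.+1}) (3 * #|P s| + #|[set p in crossings | ends p \subset sample s]|))%N.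
  by apply: leq_sum => s _; exact: cell.
rewrite big_split -big_distrr /=.
have := sum_card_sample q card_segment_ends.
have := sum_card_sample q card_crossing_ends.
have := sum_card_sample q (fun v (_ : v \in S) => cards1 v).
set nP := (\sum_s _)%N; set nX := (\sum_s _)%N; set nE := (\sum_s _)%N.
move=> hP hX hE le_n.
suff : (#|segments| * q.+1 ^ 2 <= 3 * #|S| * q.+1 ^ 3 + #|crossings|)%N.
  by move=> /leq_trans; apply; rewrite leq_add2l card_crossings.
rewrite -(@leq_pmul2r (q.+1 ^ #|V|)%N) ?expn_gt0 // mulnDl mulnAC -hE -hX.
have -> : (3 * #|S| * q.+1 ^ 3 * q.+1 ^ #|V| =
    3 * (#|S| * q.+1 ^ #|V|) * q.+1 ^ 3)%N by rewrite mulnAC -!mulnA.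
rewrite -hP.
have -> : (nE * q.+1 ^ 2 * q.+1 ^ 2 = nE * q.+1 ^ 4)%N by rewrite -mulnA -expnD.
have -> : (3 * (nP * q.+1 ^ 1) * q.+1 ^ 3 = 3 * nP * q.+1 ^ 4)%N.
  by rewrite -!mulnA -expnD.
by rewrite -mulnDl leq_mul2r le_n orbT.
Qed.

(** Every point of the line except the rightmost is the left end of a segment. *)
Lemma card_line_points i :
  (#|line_points i| <= (#|[set e | segment i e]|).+1)%N.
Proof.
pose later := [set v in line_points i | [exists w in line_points i, x v < x w]].
have le_later : (#|later| <= #|[set e | segment i e]|)%N.
  apply: leq_trans (leq_imset_card fst _).
  apply/subset_leq_card/fintype.subsetP => v; rewrite inE => /andP[vi /existsP[w0 w0P]].
  case: (@arg_minP _ _ _ w0 (fun w => (w \in line_points i) && (x v < x w)) x w0P).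
  move=> w /andP[wi vw] wmin; apply/imsetP; exists (v, w) => //.
  rewrite inE /segment vi wi vw; apply/forall_inP => u ui.
  rewrite /in_span /=; apply/negP => /andP[vu uw].
  have : x w <= x u by apply: wmin; rewrite ui.
  by rewrite leNgt uw.
rewrite -(cardsID later (line_points i)) -addn1 leq_add //.
  by apply: leq_trans le_later; apply/subset_leq_card/finset.subsetIr.
apply/card_le1_eqP => u v; rewrite !inE.
move=> /andP[nu /andP[uS ul]] /andP[nv /andP[vS vl]].
apply/eqP; rewrite -(inj_eq x_inj) eq_le !leNgt; apply/andP; split; apply/negP => lt.
  by move/negP: nu; apply; rewrite uS ul; apply/existsP; exists v; rewrite inE vS vl lt.
by move/negP: nv; apply; rewrite vS vl; apply/existsP; exists u; rewrite inE uS ul lt.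
Qed.

Lemma card_segments k : (forall i, i \in J -> (k < #|line_points i|)%N) ->
  (#|J| * k <= #|segments|)%N.
Proof.
move=> Jk.
have le_sum : (#|J| * k <= \sum_(i in J) #|[set e | segment i e]|)%N.
  rewrite -sum_nat_const; apply: leq_sum => i iJ.
  by have := leq_trans (Jk i iJ) (card_line_points i).
apply: leq_trans le_sum _.
under eq_bigr do rewrite -sum1dep_card.
rewrite pair_big_dep /= sum1dep_card.
set Q := [set p | _].
have inj : {in Q &, injective (@snd I (V * V))}.
  move=> [i e] [j f]; rewrite !inE /= => /andP[_ ie] /andP[_ jf] ef.
  by rewrite -ef in jf *; rewrite (segment_line ie jf).
rewrite -(card_in_imset inj); apply/subset_leq_card/fintype.subsetP => _ /imsetP[[i e] + ->].
by rewrite !inE /= => /andP[iJ ie]; apply/existsP; exists i; rewrite iJ.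
Qed.

(** Let [m], [s], [e] count lines, points and segments. Taking [Q] near [e / (6 s)] in the crossing
    bound gives [e^3 <= 288 s^2 m^2], and [m k <= 2 e] turns 288 into 2304. If [e < 6 s], then
    [m k < 12 s] suffices. *)
Theorem rich_lines_bound k : (1 < k)%N ->
  (forall i, i \in J -> (k <= #|line_points i|)%N) ->
  (#|J| * k ^ 3 <= 2304 * (#|S| ^ 2 + #|S| * k ^ 2))%N.
Proof.
move=> k_gt1 Jk.
have : (#|J| * k.-1 <= #|segments|)%N.
  by apply: card_segments => i /Jk; rewrite -ltnS prednK // ltnW.
have : #|J| = 0%N \/ (0 < #|S|)%N.
  have [->|[i iJ]] := set_0Vmem J; [by left; rewrite cards0 | right].
  apply: leq_trans (leq_trans _ (Jk i iJ)) _; first exact: ltnW.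
  by apply/subset_leq_card/fintype.subsetP => v; rewrite inE => /andP[].
move: crossing_bound; move: #|segments| #|J| #|S| => e m s cr ms em.
case: ms => [->|s_gt0]; first by rewrite mul0n.
have emk : (m * k <= 2 * e)%N by nia.
have [lt_e|ge_e] := ltnP e (6 * s); first by rewrite !expnS; nia.
have s6_gt0 : (0 < 6 * s)%N by rewrite muln_gt0.
pose Q := (e %/ (6 * s))%N.
have Q_gt0 : (0 < Q)%N by rewrite divn_gt0.
have leQ : (Q * (6 * s) <= e)%N by exact: leq_trunc_div.
have ltQ : (e < Q.+1 * (6 * s))%N by exact: ltn_ceil.
have := cr Q.-1; rewrite prednK // => crQ.
(* By the choice of [Q], the term linear in [s] is at most half of the left side and is absorbed. *)
have eQ : (e * Q ^ 2 <= 2 * m ^ 2)%N.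
  have : (Q * (6 * s) * Q ^ 2 <= e * Q ^ 2)%N by rewrite leq_mul2r leQ orbT.
  by move: crQ; rewrite !expnS !expn0; lia.
have eQ12 : (e <= 12 * s * Q)%N by nia.
have e2 : (e ^ 2 <= (12 * s * Q) ^ 2)%N by rewrite leq_exp2r.
have e3 : (e ^ 3 <= 288 * s ^ 2 * m ^ 2)%N.
  have h1 : (e * e ^ 2 <= e * (12 * s * Q) ^ 2)%N by rewrite leq_mul2l e2 orbT.
  have h2 : (144 * s ^ 2 * (e * Q ^ 2) <= 144 * s ^ 2 * (2 * m ^ 2))%N.
    by rewrite leq_mul2l eQ orbT.
  rewrite expnS; move: h1 h2; rewrite !expnMn; lia.
have mk3 : ((m * k) ^ 3 <= (2 * e) ^ 3)%N by rewrite leq_exp2r.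
have [->|m_gt0] := posnP m; first by rewrite mul0n.
suff : (m ^ 2 * (m * k ^ 3) <= m ^ 2 * (2304 * s ^ 2))%N.
  rewrite leq_pmul2l ?expn_gt0 ?m_gt0 // => /leq_trans; apply.
  by rewrite leq_mul2l leq_addr orbT.
move: mk3; rewrite !expnMn => mk3.
have -> : (m ^ 2 * (m * k ^ 3) = m ^ 3 * k ^ 3)%N by rewrite mulnA -expnSr.
by apply: leq_trans mk3 _; lia.
Qed.

End RichLines.

(** * Exponential estimates *)

Section Exponential.
Variable R : realType.
Implicit Types a u : R.

(** [expR a] is at most the inverse of [1 - a], and [(1 - a) (1 + a + 2 a^2) = 1 + a^2 (1 - 2 a)] is
    at least 1. *)
Lemma expR_le_quad a : a <= 1 / 2 -> expR a <= 1 + a + 2 * a ^+ 2.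
Proof.
move=> a_le; have a1 : 0 < 1 - a by lra.
have eN : 1 - a <= expR (- a) by have := expR_ge1Dx (- a).
have : expR a * (1 - a) <= 1.
  by rewrite -[leRHS](expRxMexpNx_1 a) ler_wpM2l ?expR_ge0.
rewrite -ler_pdivlMr // mul1r => /le_trans; apply.
by rewrite -[_^-1]mul1r ler_pdivrMr //; nra.
Qed.

Lemma expR_even_le a : `|a| <= 1 / 2 ->
  expR a + expR (- a) <= 2 * expR (2 * a ^+ 2).
Proof.
rewrite ler_norml => /andP[a_ge a_le].
have := expR_le_quad a_le; have : expR (- a) <= 1 + - a + 2 * (- a) ^+ 2.
  by apply: expR_le_quad; lra.
by have := expR_ge1Dx (2 * a ^+ 2); rewrite sqrrN; lra.
Qed.

(** The fourth power outweighs the cubic growth of the number of lines in [sum_small_lines]. *)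
Lemma expRN_le_pow4 u : 0 < u -> expR (- (u / 4)) <= (16 / u) ^+ 4.
Proof.
move=> u_gt0; have u16 : 0 < u / 16 by lra.
have -> : u / 4 = 4%:R * (u / 16) by field.
rewrite expRN expRM_natl -[16 / u]invf_div exprVn lef_pV2 ?posrE ?exprn_gt0 ?expR_gt0 //.
apply: lerXn2r; rewrite ?nnegrE ?expR_ge0 ?ltW //.
by have := expR_ge1Dx (u / 16); lra.
Qed.

Lemma expR_le_div a : a < 1 -> expR a <= (1 - a)^-1.
Proof.
move=> a_lt1; have a1 : 0 < 1 - a by lra.
rewrite -[expR a]invrK -expRN lef_pV2 ?posrE ?expR_gt0 //.
by have := expR_ge1Dx (- a).
Qed.

Lemma expR1_ge2 : 2 <= expR (1 : R).
Proof. by have := expR_ge1Dx (1 : R); lra. Qed.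

Lemma expRN_le_half u : 1 <= u -> expR (- u) <= 1 / 2.
Proof.
move=> u_ge1; rewrite expRN mul1r lef_pV2 ?posrE ?expR_gt0 //.
by have := expR_ge1Dx u; lra.
Qed.

End Exponential.

(** * Pigeonhole principle with code lengths *)

(* [w i] is a subprobability on the values of the [i]-th coordinate and [l t i]
   bounds the length of the corresponding code word of [b t i].  Jensen's
   inequality, in the form [1 + x <= expR x], replaces the subadditivity of
   entropy. *)
Lemma fiber_bound (R : realType) (T I : finType) (b : T -> I -> nat)
    (w : I -> nat -> R) (l : T -> I -> R) (K N : R) :
  (forall i p, 0 <= w i p) -> (forall i M, \sum_(p < M) w i p <= 1) ->
  (forall t i, expR (- l t i) <= w i (b t i)) ->
  \sum_t \sum_i l t i <= K * #|T|%:R -> 0 <= N ->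
  (forall t, #|[set t' | [forall i, b t' i == b t i]]|%:R <= N) ->
  #|T|%:R <= N * expR K.
Proof.
move=> w_ge0 w_sum lw lK N_ge0 fibN.
pose L t := \sum_i l t i.
have lower : #|T|%:R * expR (- K) <= \sum_t expR (- L t).
  have : \sum_t expR (- K) * (1 + (K - L t)) <= \sum_t expR (- L t).
    apply: ler_sum => t _.
    have -> : expR (- L t) = expR (- K) * expR (K - L t).
      by rewrite -expRD addrA addNr add0r.
    by rewrite ler_wpM2l ?expR_ge0 ?expR_ge1Dx.
  apply: le_trans; rewrite -big_distrr /= mulrC ler_wpM2l ?expR_ge0 //.
  rewrite big_split /= sumrB !sumr_const -mulr_natr mul1r -[K *+ _]mulr_natr.
  by move: lK; rewrite -/(L _); lra.
pose M := (\max_t \max_i b t i)%N.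
have bM t i : (b t i < M.+1)%N.
  rewrite ltnS; apply: leq_trans (leq_bigmax (F := fun t => \max_i b t i)%N t).
  exact: (leq_bigmax (F := b t)).
pose B t : {ffun I -> 'I_M.+1} := [ffun i => inord (b t i)].
have upper : \sum_t expR (- L t) <= N.
  apply: (@le_trans _ _ (\sum_t \prod_i w i (B t i))).
    apply: ler_sum => t _; rewrite /L -sumrN expR_sum; apply: ler_prod => i _.
    by rewrite expR_ge0 ffunE inordK // lw.
  (* Each value of the vector is taken at most [N] times, and the product weights sum to at most
     1. *)
  rewrite (partition_big B predT) //=.
  apply: (@le_trans _ _ (\sum_(v : {ffun I -> 'I_M.+1}) N * \prod_i w i (v i))).
    apply: ler_sum => v _.
    rewrite [leLHS](eq_bigr (fun _ => \prod_i w i (v i))); last by move=> t /eqP->.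
    rewrite sumr_const -mulr_natl; apply: ler_wpM2r; first exact: prodr_ge0.
    have [t /eqP tv|none] := pickP (fun t => B t == v); last first.
      by rewrite eq_card0.
    apply: le_trans (fibN t); rewrite ler_nat; apply: subset_leq_card.
    apply/fintype.subsetP => t' t'B; have t'v : B t' = v by exact/eqP.
    rewrite inE; apply/forallP => i.
    have := congr1 (fun f : {ffun I -> 'I_M.+1} => val (f i)) (etrans t'v (esym tv)).
    by rewrite /= !ffunE !inordK // => ->.
  rewrite -big_distrr /= -(bigA_distr_bigA (fun i (p : 'I_M.+1) => w i p)).
  rewrite -[leRHS]mulr1 ler_wpM2l //.
  rewrite -[leRHS](_ : \prod_(i : I) (1 : R) = 1); last by rewrite big1.
  by apply: ler_prod => i _; rewrite w_sum sumr_ge0.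
have := le_trans lower upper.
by rewrite expRN ler_pdivrMr ?expR_gt0.
Qed.

(** * Random signs *)

Section RandomSigns.
Variables (R : realType) (T : finType).
Implicit Types (A S : {set T}) (s : {ffun T -> bool}).

Definition signed_sum A s : R := \sum_(t in A) (-1) ^+ s t.

Definition differ S s s' : {set T} := [set t in S | s t != s' t].

Lemma sum_prod_signs (g : T -> bool -> R) :
  \sum_(s : {ffun T -> bool}) \prod_t g t (s t) = \prod_t (g t true + g t false).
Proof.
rewrite -(bigA_distr_bigA g); apply: eq_bigr => t _.
by rewrite big_bool.
Qed.

Lemma prod_signs_set A (u v : R) :
  \prod_t (if t \in A then u else v) = u ^+ #|A| * v ^+ #|~: A|.
Proof.
rewrite (bigID (mem A)) /= -!prodr_const; congr (_ * _).
  by apply: eq_bigr => t ->.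
by apply: eq_big => [t|t /negbTE->]; rewrite ?inE.
Qed.

Lemma norm_signed_sum A s : `|signed_sum A s| <= #|A|%:R.
Proof.
apply: le_trans (ler_norm_sum _ _ _) _; rewrite -sum1_card natr_sum.
by apply: ler_sum => t _; rewrite normr_sign.
Qed.

Lemma signed_sum_mgf A (a : R) : `|a| <= 1 / 2 ->
  \sum_s expR (a * signed_sum A s) <= 2 ^+ #|T| * expR (2 * a ^+ 2 * #|A|%:R).
Proof.
move=> a_le.
have eqs s : expR (a * signed_sum A s) =
    \prod_t (if t \in A then expR (a * (-1) ^+ s t) else 1).
  by rewrite big_distrr /= expR_sum big_mkcond.
under eq_bigr do rewrite eqs.
rewrite (sum_prod_signs (fun t (c : bool) => if t \in A then expR (a * (-1) ^+ c) else 1)).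
rewrite expRM_natr.
have -> : 2 ^+ #|T| * expR (2 * a ^+ 2) ^+ #|A| =
    \prod_t (if t \in A then 2 * expR (2 * a ^+ 2) else 2).
  by rewrite prod_signs_set -(cardsC A) exprD exprMn; ring.
apply: ler_prod => t _; case: ifP => _ /=; last by lra.
rewrite expr0 expr1 mulr1 mulrN1 addrC expR_even_le // andbT.
by rewrite addr_ge0 ?expR_ge0.
Qed.

(** Chernoff bound: with [d] disagreements the indicator is at most [expR (#|S| / 4 - 2 d)], and
    each point of [S] contributes on average [(1 + expR (- 2)) / 2 <= 5 / 8]. *)
Lemma card_differ_lt S s :
  #|[set s' | (8 * #|differ S s s'| < #|S|)%N]|%:R <=
  2 ^+ #|T| * (5 / 8 * expR (1 / 4)) ^+ #|S| :> R.
Proof.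
apply: (@le_trans _ _ (\sum_(s' : {ffun T -> bool}) expR (1 / 4) ^+ #|S| *
    \prod_t (if (t \in S) && (s t != s' t) then expR (- 2) else 1 : R))).
  rewrite -sum1_card natr_sum big_mkcond; apply: ler_sum => s' _.
  rewrite -big_mkcond /= prodr_const inE.
  have -> : #|[pred t | (t \in S) && (s t != s' t)]| = #|differ S s s'|.
    by apply: eq_card => t; rewrite !inE.
  rewrite -!expRM_natl -expRD; case: ifP => [lt_d|_]; last exact: expR_ge0.
  apply: le_trans (expR_ge1Dx _).
  have : 8 * #|differ S s s'|%:R <= #|S|%:R :> R by rewrite -natrM ler_nat ltnW.
  by lra.
rewrite -big_distrr /=.
rewrite (sum_prod_signs (fun t c => if (t \in S) && (s t != c) then expR (- 2) else 1)).
rewrite mulrC exprMn mulrA ler_wpM2r ?exprn_ge0 ?expR_ge0 //.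
have -> : 2 ^+ #|T| * (5 / 8) ^+ #|S| =
    \prod_t (if t \in S then 2 * (5 / 8) else 2) :> R.
  by rewrite prod_signs_set -(cardsC S) exprD [in RHS]exprMn mulrAC.
have e2 : expR (- 2) <= 1 / 4 :> R.
  have -> : 2 = 2%:R * 1 :> R by rewrite mulr1.
  rewrite expRN expRM_natl mul1r lef_pV2 ?posrE ?exprn_gt0 ?expR_gt0 //.
  by have := expR1_ge2 R; nra.
have := expR_ge0 (- 2 : R) => e0.
apply: ler_prod => t _; case: (t \in S) => /=; last by apply/andP; split; lra.
by case: (s t) => /=; apply/andP; split; lra.
Qed.

End RandomSigns.

(** * Rounding of a signed sum *)

Section Bucket.
Variable R : realType.
Implicit Types D X : R.

(** Truncation is 0 on negative numbers, so only the positive part of [X] is rounded; the negative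
    part is read off from [- X]. *)
Definition bucket D X : nat := Num.truncn ((X + D) / (2 * D)).

Lemma bucket_close D X X' : 0 < D ->
  bucket D X = bucket D X' -> bucket D (- X) = bucket D (- X') ->
  `|X - X'| <= 2 * D.
Proof.
move=> D_gt0 eqp eqn; have D2 : 0 < 2 * D by lra.
have close Y Y' : - D <= Y -> - D <= Y' -> bucket D Y = bucket D Y' ->
    `|Y - Y'| <= 2 * D.
  move=> Y_ge Y'_ge eqY.
  have := @truncn_itv R ((Y + D) / (2 * D)).
  have := @truncn_itv R ((Y' + D) / (2 * D)).
  rewrite -/(bucket D Y) -/(bucket D Y') eqY.
  rewrite !divr_ge0 ?ler_pdivlMr ?ltr_pdivrMr //; [|lra..].
  move=> /(_ isT)/andP[h1 h2] /(_ isT)/andP[h3 h4].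
  by rewrite ler_norml; apply/andP; split; move: h2 h4; rewrite -natr1; nra.
(* Sums on opposite sides of [[- D, D]] are told apart, as only the larger one has a nonzero
   bucket. *)
have far Y Y' : Y < - D -> D < Y' -> bucket D Y <> bucket D Y'.
  move=> Y_lt Y'_gt; suff [-> b_gt0] : bucket D Y = 0%N /\ (0 < bucket D Y')%N.
    by move=> b0; rewrite -b0 in b_gt0.
  rewrite /bucket truncn_gt0 ler_pdivlMr // mul1r; split; last by lra.
  apply/truncn0Pn; rewrite ler_pdivlMr // mul1r -ltNge; lra.
have [X_ge|X_lt] := leP (- D) X; have [X'_ge|X'_lt] := leP (- D) X'.
- exact: close.
- have [X_le|X_gt] := leP X D; last by have := far _ _ X'_lt X_gt; rewrite eqp.
  by rewrite -normrN opprB -[X']opprK addrC; apply: close; [lra | lra | ].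
- have [X'_le|X'_gt] := leP X' D; last by have := far _ _ X_lt X'_gt; rewrite eqp.
  by rewrite -normrN opprB -[X']opprK addrC; apply: close; [lra | lra | ].
- by rewrite -normrN opprB -[X']opprK addrC; apply: close; [lra | lra | ].
Qed.

Lemma bucket_le D X : 0 < D -> bucket D X = 0%N \/ D <= X /\ (bucket D X)%:R <= X / D.
Proof.
move=> D_gt0; have D2 : 0 < 2 * D by lra.
have [DX|XD] := leP D X; [right | left].
  split=> //; apply: (@le_trans _ _ ((X + D) / (2 * D))).
    by rewrite truncn_le divr_ge0 //; lra.
  rewrite ler_pdivrMr // mulrCA divfK ?gt_eqF //; lra.
by apply/truncn0Pn; rewrite ler_pdivlMr // mul1r -ltNge; lra.
Qed.

(** For [D <= X], [X / D <= expR (X / D - 1)], and [y >= 1] only enlarges the exponent. The factor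
    [expR (- y)] serves lines with few points. *)
Lemma bucket_le_expR D X y : 0 < D -> 1 <= y ->
  (bucket D X)%:R <= expR (- y) * expR (y / D * X).
Proof.
move=> D_gt0 y_ge1; rewrite -expRD.
have [->|[DX]] := bucket_le X D_gt0; first exact: expR_ge0.
move=> /le_trans; apply.
have XD1 : 1 <= X / D by rewrite ler_pdivlMr // mul1r.
apply: le_trans (_ : _ <= 1 + (X / D - 1)) _; first by lra.
apply: le_trans (expR_ge1Dx _) _; rewrite ler_expR.
have -> : y / D * X = y * (X / D) by ring.
by nra.
Qed.

(** Rescales [t <= expR t]; for lines with many points, [v] will be the order of [X / D]. *)
Lemma bucket_le_scaled D X v : 0 < D -> 0 < v ->
  (bucket D X)%:R <= v * expR ((v * D)^-1 * X).
Proof.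
move=> D_gt0 v_gt0.
have [->|[DX]] := bucket_le X D_gt0; first by rewrite mulr_ge0 ?expR_ge0 // ltW.
move=> /le_trans; apply; rewrite -ler_pdivrMl //.
have -> : v^-1 * (X / D) = (v * D)^-1 * X by rewrite invfM; ring.
by have := expR_ge1Dx ((v * D)^-1 * X); lra.
Qed.

End Bucket.

(** * Dyadic summation *)

Section Dyadic.
Variable R : realType.

Lemma dyadic_ex (u : R) J : 1 <= u -> u < 2 ^+ J ->
  exists2 j, (j < J)%N & 2 ^+ j <= u < 2 ^+ j.+1.
Proof.
move=> u_ge1; elim: J => [|J IH] u_lt; first by move: u_lt; rewrite expr0; lra.
have [/IH[j jJ ju]|u_ge] := ltP u (2 ^+ J); first by exists j => //; exact: ltnW.
by exists J => //; rewrite u_ge.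
Qed.

Lemma lt_pow2_ex (u : R) : exists J, u < 2 ^+ J.
Proof.
exists (Num.truncn u).+1; apply: lt_trans (truncnS_gt u) _.
by rewrite -natrX ltr_nat ltn_expl.
Qed.

Lemma geometric_le2 J : \sum_(j < J) (1 / 2) ^+ j <= 2 :> R.
Proof.
suff -> : \sum_(j < J) (1 / 2) ^+ j = 2 - 2 * (1 / 2) ^+ J :> R.
  have : 0 <= (1 / 2) ^+ J :> R by apply: exprn_ge0; lra.
  by lra.
by elim: J => [|J IH]; rewrite ?big_ord0 ?big_ord_recr /= ?IH ?expr0 ?exprS; lra.
Qed.

(** Sorts the indices by the dyadic level of [u]; the levels contribute a geometric series. *)
Lemma dyadic_sum (I : finType) (P : pred I) (u g : I -> R) (wt : nat -> R) (c : R) :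
  (forall i, P i -> 1 <= u i) -> (forall j, 0 <= wt j) -> 0 <= c ->
  (forall i j, P i -> 2 ^+ j <= u i < 2 ^+ j.+1 -> g i <= wt j) ->
  (forall j, wt j * #|[set i | P i && (2 ^+ j <= u i < 2 ^+ j.+1)]|%:R <=
             c * (1 / 2) ^+ j) ->
  \sum_(i | P i) g i <= 2 * c.
Proof.
move=> u_ge1 wt_ge0 c_ge0 g_le lev_le.
have [J uJ] := lt_pow2_ex (\sum_(i | P i) u i).
pose lev j i := 2 ^+ j <= u i < 2 ^+ j.+1.
apply: (@le_trans _ _ (\sum_(i | P i) \sum_(j < J | lev j i) wt j)).
  apply: ler_sum => i Pi.
  have [j jJ lev_j] : exists2 j, (j < J)%N & lev j i.
    apply: dyadic_ex; first exact: u_ge1.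
    apply: le_lt_trans uJ; rewrite (bigD1 i) //= lerDl sumr_ge0 // => k /andP[Pk _].
    by rewrite (le_trans ler01) ?u_ge1.
  rewrite (bigD1 (Ordinal jJ)) //=; apply: ler_wpDr; first exact: sumr_ge0.
  exact: g_le.
rewrite (exchange_big_dep predT) //=.
apply: (@le_trans _ _ (\sum_(j < J) c * (1 / 2) ^+ j)).
  apply: ler_sum => j _; apply: le_trans (lev_le j).
  rewrite sumr_const mulr_natr.
  by rewrite (@eq_card _ _ [set i | P i && (2 ^+ j <= u i < 2 ^+ j.+1)]) // => i; rewrite inE.
by rewrite -big_distrr /= mulrC ler_wpM2r ?geometric_le2.
Qed.

End Dyadic.

(** * Partial coloring *)

Section PartialColoring.
Variables (R : realType) (T I : finType) (F : I -> {set T}) (A : R).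
Hypothesis A_ge1 : 1 <= A.
Hypothesis rich : forall (S : {set T}) k, (1 < k)%N ->
  (#|[set i | (k <= #|F i :&: S|)%N]| * k ^ 3)%:R <=
  A * (#|S| ^ 2 + #|S| * k ^ 2)%:R.
Variables (S : {set T}) (r b : R).
Hypothesis S_gt0 : (0 < #|S|)%N.
Hypothesis r_ge0 : 0 <= r.
Hypothesis rE : r ^+ 6 = #|S|%:R.
Hypothesis b_ge1 : 1 <= b.

(* [D] is the target discrepancy; lines with at most [D] points need no care.
   Since [D ^+ 2 = 4 * k0], random sums on lines with [k0] points are of the
   order of [D]. *)
Let s (i : I) : R := #|F i :&: S|%:R.
Let k0 : R := (b * r) ^+ 2.
Let D : R := 2 * (b * r).
Let c0 : R := A * r ^+ 6 / b ^+ 2.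

(** * Sums over lines weighted by richness *)

Lemma A_ge0 : 0 <= A.
Proof. exact: le_trans ler01 A_ge1. Qed.

Lemma root_ge1 : 1 <= r.
Proof.
rewrite leNgt; apply/negP => r_lt1.
have : r ^+ 6 < 1 by rewrite exprn_ilt1.
by rewrite rE ltNge ler1n S_gt0.
Qed.

(** [rich] concerns integers, so it is applied to the smallest number of points on a line of the
    set. *)
Lemma rich_lines_real (kappa : R) : 0 < kappa ->
  #|[set i | (1 < #|F i :&: S|)%N && (kappa <= s i)]|%:R <=
  A * (#|S|%:R ^+ 2 / kappa ^+ 3 + #|S|%:R / kappa).
Proof.
move=> kappa_gt0; set L := [set i | _].
have rhs_ge0 : 0 <= A * (#|S|%:R ^+ 2 / kappa ^+ 3 + #|S|%:R / kappa).
  by rewrite mulr_ge0 ?A_ge0 // addr_ge0 // divr_ge0 ?exprn_ge0 // ltW.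
have [->|[i0 i0L]] := set_0Vmem L; first by rewrite cards0.
case: (@arg_minnP _ i0 (mem L) (fun i => #|F i :&: S|) i0L) => i /= iL imin.
move: (iL); rewrite inE; set k := #|F i :&: S|; rewrite /s -/k => /andP[k_gt1 le_k].
have k_gt0 : 0 < k%:R :> R by rewrite ltr0n ltnW.
apply: (@le_trans _ _ (#|[set i | (k <= #|F i :&: S|)%N]|%:R)).
  by rewrite ler_nat; apply/subset_leq_card/fintype.subsetP => j /imin; rewrite inE.
have := rich S k_gt1; rewrite natrM !natrX -ler_pdivlMr ?exprn_gt0 // => /le_trans; apply.
rewrite -mulrA ler_wpM2l ?A_ge0 // natrD natrM !natrX mulrDl lerD //.
  by rewrite ler_wpM2l ?exprn_ge0 // lef_pV2 ?posrE ?exprn_gt0 // lerXn2r ?nnegrE // ltW.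
have -> : #|S|%:R * k%:R ^+ 2 / k%:R ^+ 3 = #|S|%:R / k%:R :> R.
  by field; rewrite gt_eqF.
by rewrite ler_wpM2l // lef_pV2 ?posrE.
Qed.

Lemma br_ge1 : 1 <= b * r.
Proof. by rewrite mulr_ege1 ?root_ge1. Qed.

(** At threshold [k0 * rho] the two terms are [A r^6 / (b^6 rho^3)] and [A r^4 / (b^2 rho)]; since
    [b] and [r] are at least 1, weakening [b^6] to [b^2] and [r^4] to [r^6] extracts [c0]. *)
Lemma rich_lines_scaled (rho : R) : 0 < rho ->
  #|[set i | (1 < #|F i :&: S|)%N && (k0 * rho <= s i)]|%:R <=
  c0 * ((rho ^+ 3)^-1 + rho^-1).
Proof.
move=> rho_gt0; have r1 := root_ge1; have br1 := br_ge1.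
have r_gt0 : 0 < r by lra.
have b_gt0 : 0 < b by exact: lt_le_trans b_ge1.
have k0_gt0 : 0 < k0 by rewrite exprn_gt0 //; lra.
apply: le_trans (rich_lines_real (mulr_gt0 k0_gt0 rho_gt0)) _.
have -> : c0 * ((rho ^+ 3)^-1 + rho^-1) =
    A * (r ^+ 6 / b ^+ 2 / rho ^+ 3 + r ^+ 6 / b ^+ 2 / rho) by rewrite /c0; ring.
rewrite ler_wpM2l ?A_ge0 // -rE lerD //.
  have -> : r ^+ 6 ^+ 2 / (k0 * rho) ^+ 3 = r ^+ 6 / b ^+ 6 / rho ^+ 3.
    by rewrite /k0; field; rewrite !gt_eqF.
  have i3 : 0 <= (rho ^+ 3)^-1 by rewrite invr_ge0 exprn_ge0 // ltW.
  rewrite (ler_wpM2r i3) // ler_wpM2l ?exprn_ge0 //.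
  by rewrite lef_pV2 ?posrE ?exprn_gt0 // ler_weXn2l.
have -> : r ^+ 6 / (k0 * rho) = r ^+ 4 / b ^+ 2 / rho.
  by rewrite /k0; field; rewrite !gt_eqF.
have i1 : 0 <= rho^-1 by rewrite invr_ge0 ltW.
have i2 : 0 <= (b ^+ 2)^-1 by rewrite invr_ge0 exprn_ge0 // ltW.
by rewrite (ler_wpM2r i1) // (ler_wpM2r i2) // ler_weXn2l.
Qed.

Lemma c0_ge0 : 0 <= c0.
Proof.
by rewrite divr_ge0 ?exprn_ge0 ?mulr_ge0 ?exprn_ge0 ?A_ge0 // (le_trans ler01).
Qed.

(** The level where the root lies in [[w, 2 w)] has at most [2 c0 / w^2] lines and contributes at
    most [4 c0 / w]. *)
Lemma sum_large_lines :
  \sum_(i | (1 < #|F i :&: S|)%N && (k0 < s i)) Num.sqrt (s i / k0) <= 8 * c0.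
Proof.
have br1 := br_ge1; have c0_ge := c0_ge0.
have k0_gt0 : 0 < k0 by rewrite exprn_gt0 //; lra.
have -> : 8 * c0 = 2 * (4 * c0) by ring.
apply: (@dyadic_sum _ _ _ (fun i => Num.sqrt (s i / k0)) _ (fun j => 2 ^+ j.+1)).
- move=> i /andP[_ k0s]; rewrite -[leLHS]sqrtr1 ler_wsqrtr //.
  by rewrite ler_pdivlMr // mul1r ltW.
- by move=> j; rewrite exprn_ge0.
- by rewrite mulr_ge0.
- by move=> i j _ /andP[_ /ltW].
move=> j; pose w : R := 2 ^+ j.
have w_ge1 : 1 <= w by rewrite exprn_ege1 //; lra.
have w_gt0 : 0 < w by lra.
have card_le : #|[set i | (1 < #|F i :&: S|)%N && (k0 < s i) &&
    (2 ^+ j <= Num.sqrt (s i / k0) < 2 ^+ j.+1)]|%:R <= 2 * c0 / w ^+ 2.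
  have w2_gt0 : 0 < w ^+ 2 by rewrite exprn_gt0.
  apply: (@le_trans _ _ (c0 * ((w ^+ 2 ^+ 3)^-1 + (w ^+ 2)^-1))).
    apply: le_trans (rich_lines_scaled w2_gt0); rewrite ler_nat.
    apply/subset_leq_card/fintype.subsetP => i; rewrite !inE -/w.
    move=> /andP[/andP[-> k0s] /andP[ws _]] /=.
    rewrite mulrC -ler_pdivlMr // -[leRHS]sqr_sqrtr ?divr_ge0 ?(ltW k0_gt0) ?ler0n //.
    by rewrite lerXn2r ?nnegrE ?sqrtr_ge0 // ltW.
  have -> : 2 * c0 / w ^+ 2 = c0 * ((w ^+ 2)^-1 + (w ^+ 2)^-1) by ring.
  rewrite ler_wpM2l // lerD2r lef_pV2 ?posrE ?exprn_gt0 //.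
  by rewrite -exprM ler_weXn2l.
apply: le_trans (ler_wpM2l _ card_le) _; first by rewrite exprn_ge0.
have -> : (1 / 2 : R) ^+ j = w^-1 by rewrite mul1r exprVn.
rewrite exprS -/w le_eqVlt; apply/orP; left; apply/eqP.
by field; rewrite gt_eqF.
Qed.

(** The level where [k0 / s i] lies in [[w, 2 w)] has at most [16 c0 w^3] lines, each contributing
    at most [w^-4]. *)
Lemma sum_small_lines :
  \sum_(i | (1 < #|F i :&: S|)%N && (s i <= k0)) (s i / k0) ^+ 4 <= 32 * c0.
Proof.
have br1 := br_ge1; have c0_ge := c0_ge0.
have k0_gt0 : 0 < k0 by rewrite exprn_gt0 //; lra.
have s_gt0 i : (1 < #|F i :&: S|)%N -> 0 < s i by move=> h; rewrite ltr0n ltnW.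
have -> : 32 * c0 = 2 * (16 * c0) by ring.
apply: (@dyadic_sum _ _ _ (fun i => k0 / s i) _ (fun j => (2 ^+ j) ^- 4)).
- by move=> i /andP[/s_gt0 ? sk]; rewrite ler_pdivlMr // mul1r.
- by move=> j; rewrite invr_ge0 !exprn_ge0.
- by rewrite mulr_ge0.
- move=> i j /andP[/s_gt0 si _] /andP[ju _].
  rewrite -[s i / k0]invf_div exprVn lef_pV2 ?posrE ?exprn_gt0 ?divr_gt0 //.
  by rewrite lerXn2r ?nnegrE ?exprn_ge0 ?divr_ge0 // ltW.
move=> j; pose w : R := 2 ^+ j.
have w_ge1 : 1 <= w by rewrite exprn_ege1 //; lra.
have w_gt0 : 0 < w by lra.
have card_le : #|[set i | (1 < #|F i :&: S|)%N && (s i <= k0) &&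
    (2 ^+ j <= k0 / s i < 2 ^+ j.+1)]|%:R <= 16 * c0 * w ^+ 3.
  have w2_gt0 : 0 < (2 * w)^-1 by rewrite invr_gt0; lra.
  apply: (@le_trans _ _ (c0 * (((2 * w)^-1 ^+ 3)^-1 + ((2 * w)^-1)^-1))).
    apply: le_trans (rich_lines_scaled w2_gt0); rewrite ler_nat.
    apply/subset_leq_card/fintype.subsetP => i; rewrite !inE exprS -/w.
    move=> /andP[/andP[s1 _] /andP[_ us]]; rewrite s1 /=.
    rewrite ler_pdivrMr ?mulr_gt0 //; move: us; rewrite ltr_pdivrMr ?s_gt0 // mulrC.
    exact: ltW.
  rewrite exprVn !invrK.
  have -> : 16 * c0 * w ^+ 3 = c0 * (16 * w ^+ 3) by ring.
  rewrite ler_wpM2l // exprMn.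
  have : w <= w ^+ 3 by rewrite -[leLHS]expr1 ler_weXn2l.
  have w3_ge0 : 0 <= w ^+ 3 by rewrite exprn_ge0 // ltW.
  by move: (w ^+ 3) => w3; lra.
apply: le_trans (ler_wpM2l _ card_le) _; first by rewrite invr_ge0 !exprn_ge0.
have -> : (1 / 2 : R) ^+ j = w^-1 by rewrite mul1r exprVn.
rewrite -/w le_eqVlt; apply/orP; left; apply/eqP.
by field; rewrite gt_eqF.
Qed.

(* The code for the line [i] is geometric of ratio [expR (- beta i)]. *)
Let beta i : R := if s i <= k0 then k0 / s i else 1.
Let cost i (p : nat) : R := 2 * expR (- beta i) + beta i * p%:R.
Let mean_bound i : R :=
  if s i <= k0 then 6 * 16 ^+ 4 * (s i / k0) ^+ 4 else 3 * Num.sqrt (s i / k0).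

(** * Average code length of the rounded sums *)

Lemma D_ge2 : 2 <= D.
Proof. by have := br_ge1; rewrite /D; lra. Qed.

Lemma active_gt1 i : D < s i -> (1 < #|F i :&: S|)%N.
Proof.
move=> Ds; rewrite -(ltr_nat R); apply: lt_trans Ds.
by have := D_ge2; lra.
Qed.

Lemma beta_ge1 i : D < s i -> 1 <= beta i.
Proof.
move=> Ds; have := D_ge2; rewrite /beta; case: ifP => // sk D2.
by rewrite ler_pdivlMr ?mul1r //; lra.
Qed.

Lemma sum_signs_const (u : R) : \sum_(c : {ffun T -> bool}) u = 2 ^+ #|T| * u.
Proof. by rewrite sumr_const card_ffun card_bool -[LHS]mulr_natl natrX. Qed.

(** If [s i <= k0], put [u = k0 / s i]: the moment bound gives a mean bucket of at most
    [expR (- u / 2)], hence a mean cost of at most [6 expR (- u / 4)]. Otherwise, with [v] the root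
    of [s i / k0], the mean bucket is at most [2 v] and the mean cost at most [1 + 2 v <= 3 v]. *)
Lemma mean_cost i (e : bool) : D < s i ->
  \sum_(c : {ffun T -> bool})
    cost i (bucket D ((-1) ^+ e * signed_sum R (F i :&: S) c)) <=
  2 ^+ #|T| * mean_bound i.
Proof.
move=> Ds; have br1 := br_ge1; have D2 := D_ge2; have b1 := beta_ge1 Ds.
have k0_gt0 : 0 < k0 by rewrite exprn_gt0 //; lra.
have s_gt0 : 0 < s i by lra.
have D_gt0 : 0 < D by lra.
have DD : D ^+ 2 = 4 * k0 by rewrite /D /k0; ring.
have T_gt0 : 0 < 2 ^+ #|T| :> R by rewrite exprn_gt0.
have mgf a : `|a| <= 1 / 2 ->
    \sum_(c : {ffun T -> bool}) expR (a * ((-1) ^+ e * signed_sum R (F i :&: S) c)) <=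
    2 ^+ #|T| * expR (2 * a ^+ 2 * s i).
  move=> a_le; under eq_bigr do rewrite mulrA.
  have := @signed_sum_mgf R T (F i :&: S) (a * (-1) ^+ e).
  by rewrite normrM normr_sign mulr1 exprMn sqrr_sign mulr1; apply.
rewrite /cost big_split /= sum_signs_const -big_distrr /=.
rewrite /mean_bound /beta in b1 *; case: ifP b1 => [sk u1|/negbT].
  set u := k0 / s i in u1 *.
  have u_gt0 : 0 < u by lra.
  (* The range required by the moment bound; it holds because the line has more than [D] points and
     [k0 = D^2 / 4]. *)
  have uD : `|u / D| <= 1 / 2.
    rewrite ger0_norm; last by rewrite divr_ge0 // ltW.
    rewrite ler_pdivrMr // ler_pdivrMr //.
    by move: Ds; rewrite /D /k0 => Ds; nra.
  have sum_b : \sum_(c : {ffun T -> bool})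
      (bucket D ((-1) ^+ e * signed_sum R (F i :&: S) c))%:R <=
      2 ^+ #|T| * expR (- (u / 2)).
    apply: (@le_trans _ _ (\sum_(c : {ffun T -> bool}) expR (- u) *
        expR (u / D * ((-1) ^+ e * signed_sum R (F i :&: S) c)))).
      by apply: ler_sum => c _; exact: bucket_le_expR.
    rewrite -big_distrr /= mulrC.
    apply: le_trans (ler_wpM2r (expR_ge0 _) (mgf _ uD)) _.
    rewrite -[leLHS]mulrA -expRD (ler_wpM2l (ltW T_gt0)) // ler_expR.
    have -> : 2 * (u / D) ^+ 2 * s i = u / 2.
      rewrite expr_div_n DD /u; field; by rewrite !gt_eqF.
    by lra.
  apply: (@le_trans _ _ (2 ^+ #|T| * (6 * expR (- (u / 4))))); last first.
    rewrite (ler_wpM2l (ltW T_gt0)) // -mulrA ler_wpM2l // -exprMn.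
    have -> : 16 * (s i / k0) = 16 / u by rewrite /u invf_div.
    exact: expRN_le_pow4.
  apply: (@le_trans _ _ (2 ^+ #|T| * (2 * expR (- u)) +
      u * (2 ^+ #|T| * expR (- (u / 2))))).
    by rewrite lerD2l ler_wpM2l // ltW.
  have -> : 2 ^+ #|T| * (2 * expR (- u)) + u * (2 ^+ #|T| * expR (- (u / 2))) =
    2 ^+ #|T| * (2 * expR (- u) + u * expR (- (u / 2))) by ring.
  rewrite (ler_wpM2l (ltW T_gt0)) //.
  have e1 : expR (- u) <= expR (- (u / 4)) by rewrite ler_expR; lra.
  have -> : expR (- (u / 2)) = expR (- (u / 4)) * expR (- (u / 4)).
    by rewrite -expRD; congr expR; field.
  have e2 : u * expR (- (u / 4)) <= 4.
    rewrite expRN ler_pdivrMr ?expR_gt0 //.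
    by have := expR_ge1Dx (u / 4); lra.
  have := expR_ge0 (- (u / 4)); nra.
rewrite -ltNge => ks _.
set v := Num.sqrt (s i / k0).
have v_ge1 : 1 <= v.
  by rewrite -[leLHS]sqrtr1 ler_wsqrtr // ler_pdivlMr // mul1r ltW.
have v2 : v ^+ 2 = s i / k0 by rewrite sqr_sqrtr // divr_ge0 // ltW.
have vD : `|(v * D)^-1| <= 1 / 2.
  have vD2 : 2 <= v * D by nra.
  rewrite ger0_norm ?invr_ge0; last by lra.
  by rewrite mul1r lef_pV2 ?posrE //; lra.
have sum_b : \sum_(c : {ffun T -> bool})
    (bucket D ((-1) ^+ e * signed_sum R (F i :&: S) c))%:R <= 2 ^+ #|T| * (2 * v).
  apply: (@le_trans _ _ (\sum_(c : {ffun T -> bool}) v *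
      expR ((v * D)^-1 * ((-1) ^+ e * signed_sum R (F i :&: S) c)))).
    by apply: ler_sum => c _; apply: bucket_le_scaled => //; lra.
  rewrite -big_distrr /=.
  apply: le_trans (ler_wpM2l _ (mgf _ vD)) _; first by lra.
  have -> : 2 * (v * D)^-1 ^+ 2 * s i = 1 / 2.
    rewrite exprVn exprMn v2 DD; field; by rewrite !gt_eqF.
  have eh : expR (1 / 2) <= 2 :> R.
    apply: le_trans (@expR_le_div R (1 / 2) _) _; first by lra.
    have -> : 1 - 1 / 2 = 2^-1 :> R by field.
    by rewrite invrK.
  rewrite mulrCA (ler_wpM2l (ltW T_gt0)) // mulrC ler_wpM2r //; lra.
have := @expRN_le_half R 1 (lexx _) => eh.
rewrite mul1r; apply: le_trans (lerD (lexx _) sum_b) _.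
rewrite -mulrDr (ler_wpM2l (ltW T_gt0)) //; lra.
Qed.

(** Coefficients of [mean_bound] times the constants of the two dyadic sums. *)
Definition cost_constant : R := 6 * 16 ^+ 4 * 32 + 3 * 8.

Lemma sum_mean_bound :
  \sum_(i | D < s i) mean_bound i <= cost_constant * c0.
Proof.
have k0_ge0 : 0 <= k0 by rewrite sqr_ge0.
have small_ge0 i : 0 <= (s i / k0) ^+ 4 by rewrite exprn_ge0 ?divr_ge0.
have -> : cost_constant * c0 = 6 * 16 ^+ 4 * (32 * c0) + 3 * (8 * c0).
  by rewrite /cost_constant; move: (16 ^+ 4) => q; ring.
apply: le_trans (lerD (ler_wpM2l _ sum_small_lines) (ler_wpM2l _ sum_large_lines)) => //.
rewrite !big_distrr /= big_mkcond [X in _ <= X + _]big_mkcond [X in _ <= _ + X]big_mkcond.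
rewrite -big_split /=; apply: ler_sum => i _; rewrite /mean_bound ltNge.
have [_|Ds] := leP (s i) D.
  by apply: addr_ge0; case: ifP => _ //; rewrite mulr_ge0 ?sqrtr_ge0.
rewrite (active_gt1 Ds) /=; case: (leP (s i) k0) => _ /=; first by rewrite addr0.
by rewrite add0r.
Qed.

(** A line with at most [D] points gets the constant bucket 0, which the point mass codes at no
    cost. *)
Let weight i (p : nat) : R :=
  if D < s i then (1 - expR (- beta i)) * expR (- beta i) ^+ p else (p == 0%N)%:R.

Lemma weight_ge0 i p : 0 <= weight i p.
Proof.
rewrite /weight; case: ifP => // /beta_ge1/expRN_le_half e_le.
by rewrite mulr_ge0 ?exprn_ge0 ?expR_ge0 //; lra.
Qed.

Lemma weight_sum i M : \sum_(p < M) weight i p <= 1.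
Proof.
rewrite /weight; case: (D < s i); last first.
  case: M => [|M]; first by rewrite big_ord0.
  by rewrite big_ord_recl /= big1 ?addr0.
set x := expR _; have x_ge0 : 0 <= x by exact: expR_ge0.
suff -> : \sum_(p < M) (1 - x) * x ^+ p = 1 - x ^+ M.
  by rewrite gerBl exprn_ge0.
elim: M => [|M IH]; first by rewrite big_ord0 expr0 subrr.
by rewrite big_ord_recr /= IH exprS; ring.
Qed.

(** The first term of [cost] pays for the normalizing factor: [expR (- 2 x) <= 1 - x] for
    [x = expR (- beta i) <= 1 / 2]. *)
Lemma expR_cost i p : D < s i -> expR (- cost i p) <= weight i p.
Proof.
move=> Ds; rewrite /weight Ds /cost opprD expRD.
have := expRN_le_half (beta_ge1 Ds); have := expR_ge0 (- beta i).
rewrite -(mulNr (beta i)) expRM_natr; set x := expR (- beta i) => x_ge0 x_le.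
rewrite ler_wpM2r ?exprn_ge0 // expRN -[_^-1]mul1r ler_pdivrMr ?expR_gt0 //.
by have := expR_ge1Dx (2 * x) => e_ge; nra.
Qed.

(** Otherwise colorings with equal buckets differ in fewer than [#|S| / 8] points, so by
    [card_differ_lt] every fiber is small. With mean code length at most [#|S| / 16], [fiber_bound]
    would give [1 <= (5 / 8 expR (5 / 16))^#|S|], whose base is at most [10 / 11]. *)
Theorem partial_coloring : 32 * cost_constant * A <= b ->
  exists c c' : {ffun T -> bool}, (#|S| <= 8 * #|differ S c c'|)%N /\
    forall i, `|signed_sum R (F i :&: S) c - signed_sum R (F i :&: S) c'| <= 2 * D.
Proof.
move=> b_ge; have D2 := D_ge2; have D_gt0 : 0 < D by lra.
(* The Boolean is the sign: [bucket_close] needs the buckets of a sum and of its opposite. *)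
pose B c (ie : I * bool) :=
  if D < s ie.1 then bucket D ((-1) ^+ ie.2 * signed_sum R (F ie.1 :&: S) c) else 0%N.
pose l c (ie : I * bool) : R := if D < s ie.1 then cost ie.1 (B c ie) else 0.
have lw c ie : expR (- l c ie) <= weight ie.1 (B c ie).
  rewrite /l; case: ifP => [|inactive]; first exact: expR_cost.
  by rewrite oppr0 expR0 /weight /B inactive eqxx.
have lK : \sum_c \sum_ie l c ie <= #|S|%:R / 16 * #|{ffun T -> bool}|%:R.
  rewrite exchange_big /=.
  apply: (@le_trans _ _ (\sum_(ie : I * bool | D < s ie.1) 2 ^+ #|T| * mean_bound ie.1)).
    rewrite [leRHS]big_mkcond; apply: ler_sum => -[i e] _ /=; rewrite /l /B /=.
    by case: ifP => Ds; [exact: mean_cost | rewrite big1].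
  have -> : \sum_(ie : I * bool | D < s ie.1) 2 ^+ #|T| * mean_bound ie.1 =
      2 ^+ #|T| * (2 * \sum_(i | D < s i) mean_bound i).
    transitivity (\sum_(i | D < s i) \sum_(e : bool) 2 ^+ #|T| * mean_bound i).
      by rewrite [RHS]pair_big /=; apply: eq_bigl => -[i e] /=; rewrite andbT.
    rewrite !big_distrr /=; apply: eq_bigr => i _; rewrite big_bool /=; ring.
  rewrite card_ffun card_bool natrX.
  have T_ge0 : 0 <= 2 ^+ #|T| :> R by rewrite exprn_ge0.
  rewrite mulrC; apply: ler_wpM2r => //.
  (* Two signs per line and the target [#|S| / 16] account for the factor 32, and [b <= b^2]. *)
  have b1 := b_ge1; have A1 := A_ge1; have b_gt0 : 0 < b by lra.
  have b2_gt0 : 0 < b ^+ 2 by rewrite exprn_gt0.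
  apply: le_trans (_ : 2 * (cost_constant * c0) <= _).
    by rewrite ler_wpM2l ?sum_mean_bound.
  have r6 : 0 <= r ^+ 6 by rewrite exprn_ge0.
  have -> : 2 * (cost_constant * c0) = r ^+ 6 * (2 * cost_constant * A) / b ^+ 2.
    by rewrite /c0; ring.
  rewrite ler_pdivrMr // -rE -[leRHS]mulrA ler_wpM2l //.
  have -> : 16^-1 * b ^+ 2 = b * b / 16 by rewrite expr2 mulrC.
  rewrite ler_pdivlMr //; move: b_ge; set kc := cost_constant; move: kc => kc b_ge.
  by nra.
have [//|none] := pselect (exists c c' : {ffun T -> bool},
  (#|S| <= 8 * #|differ S c c'|)%N /\
  forall i, `|signed_sum R (F i :&: S) c - signed_sum R (F i :&: S) c'| <= 2 * D).
exfalso.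
pose g : R := 5 / 8 * expR (1 / 4).
have g_ge0 : 0 <= g by rewrite mulr_ge0 ?expR_ge0.
have T_gt0 : 0 < 2 ^+ #|T| :> R by rewrite exprn_gt0.
have := @fiber_bound R _ _ B (fun ie => weight ie.1) l (#|S|%:R / 16)
  (2 ^+ #|T| * g ^+ #|S|) (fun ie => weight_ge0 ie.1) (fun ie => weight_sum ie.1) lw lK.
rewrite card_ffun card_bool natrX mulr_ge0 ?exprn_ge0 //.
have fib c : #|[set c' | [forall ie, B c' ie == B c ie]]|%:R <= 2 ^+ #|T| * g ^+ #|S|.
  apply: le_trans (card_differ_lt R S c); rewrite ler_nat.
  apply/subset_leq_card/fintype.subsetP => c'; rewrite !inE => /forallP BE.
  rewrite ltnNge; apply/negP => far; apply: none; exists c, c'; split=> // i.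
  have [sD|Ds] := leP (s i) D.
    apply: le_trans (ler_normB _ _) _.
    have := norm_signed_sum R (F i :&: S) c.
    by have := norm_signed_sum R (F i :&: S) c'; rewrite -/(s i); lra.
  have := BE (i, false); have := BE (i, true); rewrite /B /= Ds.
  rewrite expr0 expr1 !mul1r !mulN1r => /eqP en /eqP ep.
  exact: bucket_close.
move=> /(_ isT fib); rewrite -mulrA -[leLHS]mulr1 ler_pM2l //.
have -> : expR (#|S|%:R / 16) = expR (1 / 16) ^+ #|S| :> R.
  by rewrite -expRM_natl mul1r.
rewrite -exprMn leNgt => /negP; apply.
rewrite exprn_ilt1 ?mulr_ge0 ?expR_ge0 -?lt0n //.
rewrite /g -[ltLHS]mulrA -expRD.
have := @expR_le_div R (5 / 16); have -> : (1 - 5 / 16)^-1 = 16 / 11 :> R by field.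
have -> : 1 / 4 + 1 / 16 = 5 / 16 :> R by field.
have lt1 : 5 / 16 < 1 :> R by lra.
by move=> /(_ lt1); lra.
Qed.

End PartialColoring.

Lemma cost_constant_ge1 (R : realType) : 1 <= cost_constant R.
Proof.
have : 0 <= 6 * 16 ^+ 4 * 32 :> R by rewrite !mulr_ge0 ?exprn_ge0.
by rewrite /cost_constant; move: (6 * _ * 32) => u; lra.
Qed.

(** * Iterated partial coloring *)

Lemma root6 (R : realType) (n : nat) : (n%:R `^ (1 / 6)) ^+ 6 = n%:R :> R.
Proof.
rewrite -powR_mulrn ?powR_ge0 // -powRrM mul1r mulVf ?pnatr_eq0 //.
by rewrite powRr1.
Qed.

(** Induction on [#|S|]: [c] is kept on the points where it differs from [c'], and the rest is
    colored recursively. The constant 96 solves [2 + 96 * 47 / 48 = 96]. *)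
Theorem coloring_of_rich (R : realType) (T I : finType) (F : I -> {set T}) (A : R) :
  1 <= A ->
  (forall (S : {set T}) k, (1 < k)%N ->
    (#|[set i | (k <= #|F i :&: S|)%N]| * k ^ 3)%:R <=
    A * (#|S| ^ 2 + #|S| * k ^ 2)%:R) ->
  forall S : {set T}, exists c : {ffun T -> bool},
    forall i, `|signed_sum R (F i :&: S) c| <=
      96 * (32 * cost_constant R * A) * #|S|%:R `^ (1 / 6).
Proof.
move=> A_ge1 rich S; set b := 32 * cost_constant R * A.
have b_ge1 : 1 <= b by rewrite /b; have := cost_constant_ge1 R; nra.
have [m] := ubnP #|S|; elim: m S => // m IH S; rewrite ltnS => Sm.
have [S0|[t0 t0S]] := set_0Vmem S.
  exists [ffun=> false] => i; rewrite /signed_sum S0 finset.setI0 big_set0 normr0.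
  by rewrite mulr_ge0 ?powR_ge0 // mulr_ge0 // (le_trans ler01).
have S_gt0 : (0 < #|S|)%N by apply/card_gt0P; exists t0.
set r := _ `^ _.
have r_ge0 : 0 <= r by exact: powR_ge0.
have rE : r ^+ 6 = #|S|%:R by exact: root6.
have [c [c' [far close]]] :=
  partial_coloring A_ge1 rich S_gt0 r_ge0 rE b_ge1 (lexx b).
pose U := differ S c c'.
have US : U \subset S by apply/fintype.subsetP => t; rewrite inE => /andP[].
have cardU : (#|S :\: U| + #|U| = #|S|)%N.
  by rewrite cardsD (finset.setIidPr US) subnK // subset_leq_card.
have [c'' c''P] : exists c'' : {ffun T -> bool},
    forall i, `|signed_sum R (F i :&: (S :\: U)) c''| <= 96 * b * #|S :\: U|%:R `^ (1 / 6).
  by apply: IH; move: far; rewrite -/U; lia.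
set r' := _ `^ _ in c''P.
(* At most [7 / 8] of the points remain, and [47 / 48] is a rational upper bound for the sixth root
   of [7 / 8]. *)
have r'_le : r' <= 47 / 48 * r.
  have c_ge0 : 0 <= 47 / 48 * r by rewrite mulr_ge0 // divr_ge0.
  rewrite -(@ler_pXn2r _ 6) // ?nnegrE ?powR_ge0 //.
  rewrite root6 exprMn rE.
  have n_le : 8 * #|S :\: U|%:R <= 7 * #|S|%:R :> R.
    by rewrite -!natrM ler_nat; move: far; rewrite -/U; lia.
  have p_ge : 7 / 8 <= (47 / 48) ^+ 6 :> R by lra.
  by have := ler0n R #|S|; nra.
exists [ffun t => if t \in U then c t else c'' t] => i.
(* On [U] the coloring [c'] is the opposite of [c]; on the rest of [S] they cancel. *)
have halfU : signed_sum R (F i :&: U) c =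
    (signed_sum R (F i :&: S) c - signed_sum R (F i :&: S) c') / 2.
  apply: (canRL (mulfK _)); first by rewrite pnatr_eq0.
  rewrite /signed_sum -sumrB big_distrl /= big_mkcond [RHS]big_mkcond /=.
  apply: eq_bigr => t _; rewrite !inE.
  case: (t \in F i) => //=; case: (t \in S) => //=.
  by case: (c t); case: (c' t); rewrite /= ?expr0 ?expr1; lra.
have -> : signed_sum R (F i :&: S) [ffun t => if t \in U then c t else c'' t] =
    signed_sum R (F i :&: U) c + signed_sum R (F i :&: (S :\: U)) c''.
  rewrite /signed_sum (big_setID U) /=; congr (_ + _); last first.
    apply: eq_big => [t|t]; rewrite !inE; first by rewrite andbCA.
    by rewrite ffunE => /andP[/negbTE tU _]; rewrite inE tU.
  apply: eq_big => [t|t]; first by rewrite -finset.setIA (finset.setIidPr US).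
  by rewrite inE => /andP[_ tU]; rewrite ffunE tU.
apply: le_trans (ler_normD _ _) _.
have := c''P i; have := close i; rewrite halfU normrM (ger0_norm (_ : 0 <= 2^-1)) ?invr_ge0 //.
have : b * r' <= b * (47 / 48 * r) by rewrite ler_wpM2l // (le_trans ler01).
by clearbody b r r'; lra.
Qed.

(** * Point-line systems *)

(** Two points of different ordinates get equal abscissae only if [t] is minus their quotient [q],
    so any [t] above all the absolute values works. *)
Lemma generic_shear (R : realFieldType) (V : finType) (p : V -> R * R) :
  injective p -> exists t, injective (fun v => (p v).1 + t * (p v).2).
Proof.
move=> p_inj.
pose q (uv : V * V) := ((p uv.1).1 - (p uv.2).1) / ((p uv.1).2 - (p uv.2).2).
exists (1 + \sum_uv `|q uv|) => u v; set t := 1 + _ => eq_uv.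
have [eq2|ne2] := eqVneq (p u).2 (p v).2.
  apply: p_inj; rewrite (surjective_pairing (p u)) (surjective_pairing (p v)) eq2.
  by congr (_, _); move: eq_uv; rewrite eq2 => /addIr.
have ne0 : (p u).2 - (p v).2 != 0 by rewrite subr_eq0.
have tE : t = - q (u, v).
  apply: (mulIf ne0); rewrite mulNr /q divfK //.
  by move: eq_uv => /=; lra.
have q_le : `|q (u, v)| <= \sum_uv `|q uv|.
  by rewrite (bigD1 (u, v)) //= lerDl sumr_ge0.
by exfalso; have := ler_norm (- q (u, v)); rewrite normrN -tE /t; lra.
Qed.

Section PointLine.
Variables (R : realType) (T I : finType) (p : T -> R * R) (l : I -> set (R * R)).
Hypothesis p_inj : injective p.
Hypothesis l_inj : injective l.
Hypothesis l_line : forall i, is_line (l i).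

Definition incident (i : I) : {set T} := [set t | p t \in l i].

(** After a shear all abscissae differ, so a line with two points of the system is not vertical and
    has a slope and an intercept. *)
Lemma rich_incident (S : {set T}) k : (1 < k)%N ->
  (#|[set i | (k <= #|incident i :&: S|)%N]| * k ^ 3 <=
   2304 * (#|S| ^ 2 + #|S| * k ^ 2))%N.
Proof.
move=> k_gt1; set J := [set i | _].
have [t x_inj] := generic_shear p_inj.
set x := fun v => _ in x_inj; pose y v := (p v).2.
have slopes (j : {i | i \in J}) : exists ac : R * R, forall q : R * R,
    l (val j) q <-> q.2 = ac.1 * (q.1 + t * q.2) + ac.2.
  have [al [be [ga [ne lE]]]] := l_line (val j).
  have inE' q : l (val j) q <-> al * (q.1 + t * q.2) + (be - al * t) * q.2 = ga.
    rewrite lE /=; split=> h; lra.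
  have [d0|d_neq0] := eqVneq (be - al * t) 0; last first.
    exists (- al / (be - al * t), ga / (be - al * t)) => q; rewrite inE' /=.
    move: d_neq0 q.2 (q.1 + t * q.2) => + Y X; move: (be - al * t) => d d_neq0.
    by split=> [<-|->]; field.
  have al_neq0 : al != 0.
    by apply/eqP => al0; apply: ne; move: d0; rewrite al0 mul0r subr0 => ->.
  have : (k <= #|incident (val j) :&: S|)%N by have := valP j; rewrite inE.
  move=> /(leq_trans k_gt1)/card_gt1P[u [v [uI vI]]].
  have onl w : w \in incident (val j) :&: S -> al * x w = ga.
    move=> /finset.setIP[+ _]; rewrite finset.in_set => /set_mem/inE'.
    by rewrite d0 mul0r addr0.
  by move=> /eqP[]; apply/x_inj/(mulfI al_neq0); rewrite !onl.
have [ac acP] := choice slopes.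
have := @rich_lines_bound R T {i | i \in J} x y (fun j => (ac j).1) (fun j => (ac j).2)
  x_inj _ S [set: {i | i \in J}] k k_gt1.
have -> : #|[set: {i | i \in J}]| = #|J| by rewrite cardsT card_sig.
apply.
(* [acP] describes the line on the whole plane, so slope and intercept determine it as a set. *)
- move=> i j ai ci; apply/val_inj/l_inj/seteqP; split=> q; rewrite !acP ai ci //.
- move=> j _; have := valP j; rewrite inE => /leq_trans; apply.
  apply/subset_leq_card/fintype.subsetP => v /finset.setIP[].
  rewrite 2!finset.in_set => /set_mem/acP vE ->; exact/eqP.
Qed.

Theorem point_line_coloring : exists c : {ffun T -> bool}, forall i,
  `|signed_sum R (incident i) c| <=
  96 * (32 * cost_constant R * 2304%:R) * #|T|%:R `^ (1 / 6).
Proof.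
have [|S k k_gt1|c cP] := @coloring_of_rich R T I incident 2304%:R _ _ [set: T].
- by rewrite ler1n.
- by rewrite -natrM ler_nat rich_incident.
- by exists c => i; have := cP i; rewrite finset.setIT cardsT.
Qed.

End PointLine.

Theorem theoremA1 (R : realType) :
  exists C : R, 0 < C /\
    forall (P : {fset R * R}) (L : {fset set (R * R)}),
      point_line_system P L ->
      disc (adjacency_mx P L) <= C * (#|` P|%:R `^ (1 / 6)).
Proof.
set C : R := 96 * (32 * cost_constant R * 2304%:R).
have C_gt0 : 0 < C.
  have k_gt0 : 0 < cost_constant R := lt_le_trans ltr01 (cost_constant_ge1 R).
  by rewrite /C !mulr_gt0 ?ltr0n.
exists C; split=> // P L PL.
pose p (j : 'I_#|` P|) := nth (0, 0) (enum_fset P) j.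
pose l (i : 'I_#|` L|) := nth set0 (enum_fset L) i.
have p_inj : injective p.
  by move=> j j' /eqP; rewrite nth_uniq ?fset_uniq ?ltn_ord // => /eqP/val_inj.
have l_inj : injective l.
  by move=> i i' /eqP; rewrite nth_uniq ?fset_uniq ?ltn_ord // => /eqP/val_inj.
have l_line i : is_line (l i) by apply: PL; exact: mem_nth.
have [c cP] := point_line_coloring p_inj l_inj l_line.
have [_ /(_ c) disc_le] := disc_min (adjacency_mx P L).
apply: le_trans disc_le _; rewrite norm_cV_max; apply/bigmax_leP; split.
  by rewrite mulr_ge0 ?powR_ge0 // ltW.
move=> i _; have := cP i; rewrite card_ord; apply: le_trans.
suff -> : (adjacency_mx P L *m sign_vec R c) i 0 = signed_sum R (incident p l i) c by [].
rewrite mxE /signed_sum [RHS]big_mkcond /=; apply: eq_bigr => j _.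
by rewrite !mxE inE; case: (_ \in _); rewrite ?mul1r ?mul0r.
Qed.
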